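(* Consider, for $\tau>0$, the planar system of delay differential equations \[ x'(t)=x(t)-y(t)-x(t-\tau)\left(x^2(t)+y^2(t)\right),\qquad y'(t)=x(t)+y(t)-y(t-\tau)\left(x^2(t)+y^2(t)\right). \] For any $\tau>0$, there exist infinitely many unstable periodic solutions of the system with constant radius and constant angular velocity. Moreover, there exists a positive $\tau^*$ such that, for $0<\tau<\tau^*$, the system admits only one asymptotically stable periodic solution with constant radius and constant angular velocity.
   Context: In polar coordinates $(x,y)=r(\cos\theta,\sin\theta)$ the system reads \[ r'(t)=r(t)\left(1-r(t)r(t-\tau)\cos(\theta(t)-\theta(t-\tau))\right),\qquad \theta'(t)=1+r(t)r(t-\tau)\sin(\theta(t)-\theta(t-\tau)). \] A periodic solution with constant radius and angular velocity is a solution of the form $(r(t),\theta(t))=(\rho,\omega t)$ with constants $\rho>0$, $\omega\in\mathbb{R}$ (solutions differing by a phase shift are identified). Stability convention: setting $v=\theta'$, one obtains the coupled system \[ r'(t)=r(t)\left(1-r(t)r(t-\tau)\cos\int_{t-\tau}^t v(s)\,ds\right),\qquad v(t)=1+r(t)r(t-\tau)\sin\int_{t-\tau}^t v(s)\,ds, \] for which $(r,v)=(\rho,\omega)$ is an equilibrium. The periodic solution $(\rho,\omega t)$ is called asymptotically stable (respectively unstable) if the equilibrium $(\rho,\omega)$ of this coupled system is locally asymptotically stable (respectively unstable) in the sense of Lyapunov, with histories $(r_t,v_t)$ in the state space $C([-\tau,0];\mathbb{R})\times L^1([-\tau,0];\mathbb{R})$. *)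

(* Defs.v *)
From HB Require Import structures.
From mathcomp Require Import all_boot all_order all_algebra.
From mathcomp Require Import all_classical all_reals all_analysis.

Set Implicit Arguments.
Unset Strict Implicit.
Unset Printing Implicit Defensive.

Import Order.TTheory GRing.Theory Num.Theory.
Import numFieldNormedType.Exports.

Local Open Scope classical_set_scope.
Local Open Scope ring_scope.

Definition planar_solution (R : realType) (tau : R) (x y : R -> R) : Prop :=
  forall t : R,
    is_derive t 1 x (x t - y t - x (t - tau) * (x t ^+ 2 + y t ^+ 2)) /\
    is_derive t 1 y (x t + y t - y (t - tau) * (x t ^+ 2 + y t ^+ 2)).

(* Solutions are taken up to a phase shift, so that the pair (rho, omega)
   stands for the solution.  The angular velocity omega = 0 is not excluded
   explicitly: the equations themselves rule it out. *)
Definition rotating_solution (R : realType) (tau rho omega : R) : Prop :=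
  0 < rho /\
  planar_solution tau (fun t => rho * cos (omega * t))
                      (fun t => rho * sin (omega * t)).

(* Solutions on [-tau, T] of
     r'(t) = r(t) (1 - r(t) r(t - tau) cos (\int_(t - tau)^t v)),
     v(t)  = 1 + r(t) r(t - tau) sin (\int_(t - tau)^t v),
   with v = theta'.  On [-tau, 0] the pair (r, v) is the initial history, in
   C([-tau, 0]) x L^1([-tau, 0]). *)
Definition coupled_solution (R : realType) (tau T : R) (r v : R -> R) : Prop :=
  [/\ {within `[- tau, T], continuous r},
      (@lebesgue_measure R).-integrable `[- tau, T] (EFin \o v) &
      forall t : R, 0 < t < T ->
        let phase := \int[@lebesgue_measure R]_(s in `[t - tau, t]) v s in
        is_derive t 1 r (r t * (1 - r t * r (t - tau) * cos phase)) /\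
        v t = 1 + r t * r (t - tau) * sin phase].

(* The distance in C([-tau, 0]) x L^1([-tau, 0]) from (r_t, v_t) to the
   constant history (rho, omega). *)
Definition history_dist (R : realType) (tau rho omega : R) (r v : R -> R)
    (t : R) : R :=
  sup [set `|r s - rho| | s in `[t - tau, t]] +
  \int[@lebesgue_measure R]_(s in `[t - tau, t]) `|v s - omega|.

(* Quantifying over solutions on arbitrary bounded intervals, rather than over
   global ones, makes a solution that blows up in finite time a witness of
   instability. *)
Definition lyapunov_stable (R : realType) (tau rho omega : R) : Prop :=
  forall eps : R, 0 < eps -> exists2 delta : R, 0 < delta &
    forall (T : R) (r v : R -> R), 0 < T -> coupled_solution tau T r v ->
      history_dist tau rho omega r v 0 < delta ->
      forall t : R, 0 <= t <= T -> history_dist tau rho omega r v t < eps.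

(* The first clause makes the attraction requirement non-vacuous: every
   history close to the equilibrium is continued by a global solution. *)
Definition locally_attractive (R : realType) (tau rho omega : R) : Prop :=
  exists2 delta : R, 0 < delta &
    (forall phi psi : R -> R,
       {within `[- tau, 0], continuous phi} ->
       (@lebesgue_measure R).-integrable `[- tau, 0] (EFin \o psi) ->
       history_dist tau rho omega phi psi 0 < delta ->
       exists r v : R -> R,
         (forall T : R, 0 < T -> coupled_solution tau T r v) /\
         (forall s : R, - tau <= s <= 0 -> r s = phi s /\ v s = psi s)) /\
    (forall r v : R -> R,
       (forall T : R, 0 < T -> coupled_solution tau T r v) ->
       history_dist tau rho omega r v 0 < delta ->
       history_dist tau rho omega r v t @[t --> +oo] --> (0 : R)).

Definition asymptotically_stable (R : realType) (tau rho omega : R) : Prop :=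
  lyapunov_stable tau rho omega /\ locally_attractive tau rho omega.

Definition unstable (R : realType) (tau rho omega : R) : Prop :=
  ~ lyapunov_stable tau rho omega.

(* Main.v *)
Require Import Defs.
From HB Require Import structures.
From mathcomp Require Import all_boot all_order all_algebra.
From mathcomp Require Import all_classical all_reals all_analysis.
From mathcomp Require Import ring lra.

Import Order.TTheory GRing.Theory Num.Theory.
Import numFieldNormedType.Exports.

Local Open Scope classical_set_scope.
Local Open Scope ring_scope.

(** The polar system is invariant under rotation, so a solution turning at
    constant speed is an equilibrium [(rho, omega)] of the coupled system, and
    substitution gives [rho^2 cos phi = 1] and [omega - 1 = tan phi], where
    [phi = omega tau] is the phase accumulated over one delay
    ([rotating_solutionP]).  The equation [phi / tau - 1 = tan phi] has a root
    with positive cosine in every interval [2 n pi, 2 n pi + pi / 2] with [n]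
    large ([fast_rotations_exist]); for a short delay it has exactly one root
    near zero ([slow_rotation_exists]), and at all other roots [k = omega - 1]
    satisfies [k tau >= 9/10] in absolute value ([slow_rotation_unique]).  Put
    [u = r / rho - 1], let [D] be the integral of [v - omega] over the delay, and
    let a subscript [tau] denote delayed values.  In these relative coordinates
    the equations depend on the equilibrium through [k] alone:
    [u' = (1 + u) (1 - h (cos D - k sin D))] and
    [v - omega = - k + h (k cos D + sin D)], with
    [h = (1 + u) (1 + u_tau)] ([coupled_solution_relative]).

    Small [k] and [tau].  The radial equation is [u' = - u - u_tau] up to a small
    error, hence [u' = - 2 u] up to a small error once [u - u_tau] is estimated
    by the mean value theorem, while [v - omega] is bounded by the size of the
    recent past and is only integrated over a window of length [tau].  A
    continuous induction then shows that [u] and the L^1 norm of [v - omega] over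
    the delay both stay below [2 delta exp (- t / 4)] if they start below [delta]
    ([exponential_decay]).  This is stability and attraction at once.

    Large [k].  Write [theta] for the angular deviation (up to the sign of [k],
    which a reflection removes).  To leading order [u' = k (theta - theta_tau)]
    and [theta' = k (u + u_tau)], so [p = u + theta] and [q = u - theta] satisfy
    [p' = k (p + q_tau)] and [q' = - k (q + p_tau)].  Along an orbit growing like
    [exp (2 k t / 3)] the delayed terms carry a factor [exp (- 2 k tau / 3)],
    which is at most 5/8, and the cone given by [|q| <= c p] is invariant
    ([cone_escape]).  A small history inside the cone therefore leaves every
    small neighbourhood ([fast_rotation_unstable]).  For a short delay this covers
    all equilibria except the one near zero phase.

    Global solutions come from Picard iteration for a bounded Lipschitz delay
    equation ([delay_equation_exists]), applied to the polar equations with the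
    radius clamped; stability (or the assumption of stability, in the
    instability proof) shows that the clamp is never reached. *)

(** * Elementary calculus *)

Section Calculus.
Context {R : realType}.
Implicit Types (f g : R -> R) (a b t x : R).

(** An epsilon-delta form of continuity on a segment that leaves no trace of the
    subspace topology, for the functions whose continuity is checked by hand. *)
Lemma within_itv_continuousP f a b :
  {within `[a, b], continuous f} <->
  forall x, a <= x <= b -> forall e : R, 0 < e ->
    exists2 d : R, 0 < d & forall y, a <= y <= b -> `|x - y| < d -> `|f x - f y| < e.
Proof.
split=> [cf x xab e e0|H].
  have xin : (`[a, b]%classic : set R) x by rewrite /= in_itv.
  move/subspace_continuousP : cf => /(_ x xin) /cvgrPdist_lt /(_ e e0).
  rewrite near_withinE => -[d /= d0 dP].
  exists d => // y yab xyd; apply: dP => //=.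
apply/subspace_continuousP => x; rewrite /= in_itv/= => xab.
apply/cvgrPdist_lt => e e0; have [d d0 dP] := H x xab e e0.
rewrite near_withinE; exists d => // y /= xyd; rewrite in_itv/= => yab.
exact: dP.
Qed.

(** Continuous induction: at the infimum of the set where [f <= 0] the hypothesis
    makes [f] positive, hence positive on a neighbourhood, contrary to the choice
    of the infimum. *)
Lemma positive_by_continuity f a b :
  {within `[a, b], continuous f} ->
  (forall t, a <= t <= b -> (forall s, a <= s < t -> 0 < f s) -> 0 < f t) ->
  forall t, a <= t <= b -> 0 < f t.
Proof.
move=> /within_itv_continuousP cf step t0 t0ab; rewrite ltNge; apply/negP => ft0.
pose A := [set t | a <= t <= b /\ f t <= 0].
have A0 : A !=set0 by exists t0.
have lbA : lbound A a by move=> x [/andP[]].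
have hA : has_inf A by split => //; exists a.
pose m := inf A.
have am : a <= m by apply: lb_le_inf.
have mt0 : m <= t0 by apply: ge_inf; [exists a|].
have mab : a <= m <= b by rewrite am (le_trans mt0)//; case/andP: t0ab.
have fm : 0 < f m.
  apply: step => // s /andP[sa sm]; rewrite ltNge; apply/negP => fs.
  move: (sm); rewrite ltNge => /negP; apply; apply: ge_inf; first by exists a.
  split=> //; rewrite sa/=; apply: ltW; apply: lt_le_trans (sm) _.
  by case/andP: mab.
have [d d0 dP] := cf m mab (f m) fm.
have [x [xab fx] xmd] := inf_adherent d0 hA.
have mx : m <= x by apply: ge_inf; [exists a|].
have : `|m - x| < d by rewrite distrC ger0_norm ?subr_ge0// ltrBlDl.
move=> /(dP x xab); rewrite ltNge => /negP; apply.
by rewrite ler_normr; apply/orP; left; lra.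
Qed.

Lemma nondecreasing_of_is_derive f df a b : a <= b ->
  (forall x, a < x < b -> is_derive x 1 f (df x)) ->
  (forall x, a < x < b -> 0 <= df x) ->
  {within `[a, b], continuous f} -> f a <= f b.
Proof.
rewrite le_eqVlt => /predU1P[->//|ab] fd df0 cf.
have fd' x : x \in `]a, b[ -> is_derive x 1 f (df x).
  by rewrite in_itv/=; exact: fd.
have [c + fE] := MVT ab fd' cf.
rewrite in_itv/= => /df0 dfc; rewrite -subr_ge0 fE.
by rewrite mulr_ge0// subr_ge0 ltW.
Qed.

Lemma lipschitz_of_is_derive f df a b B : a <= b ->
  (forall x, a < x < b -> is_derive x 1 f (df x)) ->
  (forall x, a < x < b -> `|df x| <= B) ->
  {within `[a, b], continuous f} -> `|f b - f a| <= B * (b - a).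
Proof.
rewrite le_eqVlt => /predU1P[->|ab]; first by rewrite !subrr normr0 mulr0.
move=> fd dfB cf.
have fd' x : x \in `]a, b[ -> is_derive x 1 f (df x).
  by rewrite in_itv/=; exact: fd.
have [c + fE] := MVT ab fd' cf.
rewrite in_itv/= => /dfB dfc; rewrite fE normrM ler_pM//.
by rewrite ger0_norm// subr_ge0 ltW.
Qed.

Lemma is_derive_continuous f x df : is_derive x 1 f df -> {for x, continuous f}.
Proof. by case=> fd _; apply/differentiable_continuous/derivable1_diffP. Qed.

Lemma ler_norm_sin x : `|sin x| <= `|x|.
Proof.
wlog x0 : x / 0 <= x => [H|].
  have [/H//|/ltW x0] := leP 0 x.
  by rewrite -normrN -sinN -[leRHS]normrN; apply: H; rewrite oppr_ge0.
have := @lipschitz_of_is_derive sin cos 0 x 1 x0.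
rewrite sin0 !subr0 mul1r (ger0_norm x0); apply.
- by move=> y _; exact: cos_max.
- by apply: continuous_subspaceT; exact: continuous_sin.
Qed.

Lemma ler_normM x y (A B : R) : `|x| <= A -> `|y| <= B -> `|x * y| <= A * B.
Proof. by move=> xA yB; rewrite normrM ler_pM. Qed.

Lemma ler_normD2 x y (A B : R) : `|x| <= A -> `|y| <= B -> `|x + y| <= A + B.
Proof. by move=> xA yB; apply: (le_trans (ler_normD _ _)); exact: lerD. Qed.

Lemma onem_cosE x : 1 - cos x = 2 * sin (x / 2) ^+ 2.
Proof.
have -> : cos x = cos (x / 2 *+ 2) by congr cos; rewrite mulr2n; field.
by rewrite cos_mulr2n sin2cos2 mulr2n; ring.
Qed.

Lemma onem_cos_ge0 x : 0 <= 1 - cos x.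
Proof. by rewrite subr_ge0 cos_le1. Qed.

Lemma onem_cos_le x : 1 - cos x <= x ^+ 2 / 2.
Proof.
rewrite onem_cosE.
have := ler_norm_sin (x / 2); rewrite -ler_sqr ?nnegrE// !real_normK ?num_real//.
move=> h; apply: (@le_trans _ _ (2 * (x / 2) ^+ 2)); first by lra.
by rewrite le_eqVlt; apply/orP; left; apply/eqP; field.
Qed.

Lemma ler_norm_sinB x : `|x| <= 1 -> `|sin x - x| <= x ^+ 2.
Proof.
wlog x0 : x / 0 <= x => [H|].
  have [/H//|/ltW x0] := leP 0 x; move=> x1.
  rewrite -normrN -sqrrN.
  have -> : - (sin x - x) = sin (- x) - (- x) by rewrite sinN; ring.
  by apply: H; rewrite ?normrN// oppr_ge0.
rewrite (ger0_norm x0) => x1.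
(* The derivative [cos y - 1] is at most [y ^+ 2 / 2 <= x] in absolute value. *)
have := @lipschitz_of_is_derive (fun y => sin y - y) (fun y => cos y - 1) 0 x x x0.
rewrite sin0 !subr0 -expr2; apply.
- move=> y /andP[y0 yx]; rewrite distrC ger0_norm ?onem_cos_ge0//.
  apply: le_trans (onem_cos_le y) _; nra.
- apply: continuous_subspaceT => y; apply: continuousB; first exact: continuous_sin.
  exact: cvg_id.
Qed.

Lemma cos_ge x : 1 - x ^+ 2 / 2 <= cos x.
Proof. by have := onem_cos_le x; lra. Qed.

End Calculus.

(** * Integrals over intervals *)

Section Integrals.
Context {R : realType}.
Local Notation mu := (@lebesgue_measure R).
Implicit Types (f g : R -> R) (a b c t x : R).

Lemma integrable_itv_sub f a b c d : a <= c -> d <= b ->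
  mu.-integrable `[a, b] (EFin \o f) -> mu.-integrable `[c, d] (EFin \o f).
Proof.
move=> ac db; apply: integrableS => //.
by apply: subset_itv; rewrite bnd_simp.
Qed.

Lemma Rintegral_itv_add f a b c : a <= b -> b <= c ->
  mu.-integrable `[a, c] (EFin \o f) ->
  \int[mu]_(x in `[a, c]) f x =
  \int[mu]_(x in `[a, b]) f x + \int[mu]_(x in `[b, c]) f x.
Proof.
move=> ab bc fi.
have := @Rintegral_itvB _ f (BLeft a) (BRight c) b fi.
rewrite !bnd_simp => /(_ ab bc) h.
have := @Rintegral_itv_obnd_cbnd _ b (BRight c) f.
rewrite -h => <-; first by rewrite addrC subrK.
by apply: integrableS fi => //; apply: subset_itv; rewrite bnd_simp.
Qed.

Lemma Rintegral_itv_cst a b c : a <= b -> \int[mu]_(_ in `[a, b]) c = c * (b - a).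
Proof.
move=> ab; have hm : fine (mu `[a, b]) = b - a.
  rewrite lebesgue_measure_itv/= lte_fin.
  by case: ltP => [_|ba] //=; rewrite (le_anti (introT andP (conj ab ba))) subrr.
by rewrite Rintegral_cst// -hm.
Qed.

Lemma Rintegral_itv_oo f a b : mu.-integrable `[a, b] (EFin \o f) ->
  \int[mu]_(x in `]a, b[) f x = \int[mu]_(x in `[a, b]) f x.
Proof.
move=> fi; rewrite Rintegral_itv_obnd_cbnd; last first.
  by apply: integrableS fi => //; apply: subset_itv; rewrite bnd_simp.
rewrite Rintegral_itv_bndo_bndc//.
by apply: integrableS fi => //; apply: subset_itv; rewrite bnd_simp.
Qed.

(** The bound is only asked in the interior: a solution is unconstrained at the
    end of its interval, and its history at time zero is arbitrary. *)
Lemma le_Rintegral_itv f a b B : a <= b ->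
  mu.-integrable `[a, b] (EFin \o f) ->
  (forall x, a < x < b -> f x <= B) ->
  \int[mu]_(x in `[a, b]) f x <= B * (b - a).
Proof.
move=> ab fi fB.
have iB : mu.-integrable `[a, b] (EFin \o cst B).
  apply: continuous_compact_integrable; first exact: segment_compact.
  by apply: continuous_subspaceT => x; exact: cvg_cst.
have sub : `]a, b[ `<=` (`[a, b] : set R) by apply: subset_itv; rewrite bnd_simp.
rewrite -Rintegral_itv_cst// -!Rintegral_itv_oo//.
apply: le_Rintegral => //.
- exact: integrableS fi.
- exact: integrableS iB.
Qed.

Lemma continuous_integrable_itv g a b : continuous g ->
  mu.-integrable `[a, b] (EFin \o g).
Proof.
move=> cg; apply: continuous_compact_integrable; first exact: segment_compact.
exact: continuous_subspaceT.
Qed.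

(** Being zero on the negative half-line, this primitive can be added to a
    prescribed past without altering it; that is how Picard iterates keep their
    history. *)
Lemma primitive_from0 g : continuous g ->
  let J t := \int[mu]_(s in `[0, t]) g s in
  [/\ forall t, t <= 0 -> J t = 0, continuous J &
      forall t, 0 < t -> is_derive t 1 J (g t)].
Proof.
move=> cg J.
have J0 t : t <= 0 -> J t = 0.
  rewrite le_eqVlt => /predU1P[->|t0]; rewrite /J.
    by rewrite set_itv1 Rintegral_set1.
  by rewrite set_itv_ge ?Rintegral_set0// -leNgt bnd_simp.
have Jd t : 0 < t -> is_derive t 1 J (g t).
  move=> t0; have tt1 : t < t + 1 by rewrite ltrDl.
  have := @continuous_FTC1_closed _ g 0 t (t + 1) tt1
    (@continuous_integrable_itv g _ _ cg) t0 (cg t).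
  by case=> Jd <-; rewrite derive1E; exact/derivableP.
split => // t.
have [t0|t0|->] := ltgtP t 0.
- have : \forall s \near t, J s = 0.
    by near=> s; apply: J0; apply: ltW; near: s; exact: lt_nbhsl.
  move=> Jt; rewrite /continuous_at (J0 _ (ltW t0)).
  by apply: cvg_near_cst.
- exact: is_derive_continuous (Jd _ t0).
- rewrite /continuous_at J0//.
  have := @parameterized_integral_continuous _ 0 1 g ler01
    (@continuous_integrable_itv g _ _ cg).
  move=> /within_itv_continuousP cJ.
  apply/cvgrPdist_lt => e e0.
  have /cJ/(_ e e0)[d d0 dP] : 0 <= (0:R) <= 1 by rewrite lexx ler01.
  near=> s; have [s0|s0] := leP s 0; first by rewrite (J0 s)// subrr normr0.
  have := dP s; rewrite -![parameterized_integral _ _ _ _]/(J _) (J0 0)//; apply.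
    by rewrite (ltW s0)/= ltW//; near: s; apply: lt_nbhsl; exact: ltr01.
  by near: s; exists d.
Unshelve. all: by end_near. Qed.

Lemma integrable_itv_glue f g (h : R -> R) a b c : a <= b -> b <= c ->
  mu.-integrable `[a, b] (EFin \o f) -> mu.-integrable `[b, c] (EFin \o g) ->
  (forall x, x <= b -> h x = f x) -> (forall x, b < x -> h x = g x) ->
  mu.-integrable `[a, c] (EFin \o h).
Proof.
move=> ab bc fi gi hf hg.
have fi' : mu.-integrable `[a, c] (EFin \o f \_ `[a, b]).
  rewrite -restrict_EFin; apply/integrable_restrict => //=.
  by rewrite setIidr//; apply: subset_itv; rewrite bnd_simp.
have gi' : mu.-integrable `[a, c] (EFin \o g \_ `]b, c]).
  rewrite -restrict_EFin; apply/integrable_restrict => //=.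
  rewrite setIidr; last by apply: subset_itv; rewrite bnd_simp.
  by apply: integrableS gi => //; apply: subset_itv; rewrite bnd_simp.
have : mu.-integrable `[a, c]
    ((EFin \o f \_ `[a, b]) \+ (EFin \o g \_ `]b, c]))%E by exact: integrableD.
apply: eq_integrable => // x; rewrite inE/= in_itv/= => /andP[ax xc].
rewrite /= -EFinD; congr EFin; rewrite /patch.
have [xb|bx] := leP x b.
  rewrite mem_set ?memNset ?addr0 ?hf//= ?in_itv/= ?ax ?xb//.
  by rewrite ltNge xb.
rewrite memNset ?mem_set ?add0r ?hg//= ?in_itv/= ?bx ?xc//.
by rewrite ax/= leNgt bx.
Qed.

(** The integrand [f] agrees with a continuous [g] only in the interior, so that
    the angular velocity, which jumps at time zero, is allowed. *)
Lemma Rintegral_derive (F : R -> R) f g a b : a <= b ->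
  mu.-integrable `[a, b] (EFin \o f) -> continuous g ->
  (forall x, a < x < b -> f x = g x) ->
  (forall x, a < x < b -> is_derive x 1 F (g x)) ->
  {within `[a, b], continuous F} ->
  \int[mu]_(x in `[a, b]) f x = F b - F a.
Proof.
rewrite le_eqVlt => /predU1P[->|ab].
  by move=> *; rewrite set_itv1 Rintegral_set1 subrr.
move=> fi cg fg Fg cF.
have gi : mu.-integrable `[a, b] (EFin \o g) by exact: continuous_integrable_itv.
transitivity (\int[mu]_(x in `[a, b]) g x).
  rewrite -!Rintegral_itv_oo//.
  by apply: eq_Rintegral => x; rewrite inE/= in_itv/=; exact: fg.
rewrite /Rintegral (@continuous_FTC2 _ g F)//.
- exact: continuous_subspaceT.
- move/(continuous_within_itvP _ ab) : cF => [_ Fa Fb]; split => // x.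
  by rewrite in_itv/= => /Fg[].
- by move=> x; rewrite in_itv/= => /Fg[_ <-]; rewrite derive1E.
Qed.

End Integrals.

Section GeometricLimit.
Context {R : realType}.

(** The limit is the supremum of the lower ends of the nested segments
    [x n - 2 M / 2^n, x n + 2 M / 2^n], which yields the error bound at once. *)
Lemma geometric_sequence_limit (x : nat -> R) (M : R) :
  (forall n, `|x n.+1 - x n| <= M / 2 ^+ n) ->
  exists l, forall n, `|l - x n| <= 2 * M / 2 ^+ n.
Proof.
move=> xM.
pose a n := x n - 2 * M / 2 ^+ n; pose b n := x n + 2 * M / 2 ^+ n.
have halfS n : 2 * M / 2 ^+ n.+1 = M / 2 ^+ n.
  by rewrite exprS invfM; field; rewrite expf_neq0.
have aS n : a n <= a n.+1.
  have := xM n; rewrite ler_norml /a halfS => /andP[+ _].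
  by rewrite -[2 * M / _]mulrA; lra.
have bS n : b n.+1 <= b n.
  have := xM n; rewrite ler_norml /b halfS => /andP[_ +].
  by rewrite -[2 * M / _]mulrA; lra.
have a_nd : {homo a : m n / (m <= n)%N >-> m <= n}.
  by apply: homo_leq => //; exact: le_trans.
have b_ni m n : (m <= n)%N -> b n <= b m.
  elim: n => [|n IH]; first by rewrite leqn0 => /eqP->.
  by rewrite leq_eqVlt => /predU1P[->//|/IH]; exact: le_trans.
have M0 : 0 <= M by have := xM 0; rewrite expr0 divr1; apply: le_trans.
have ab n : a n <= b n.
  have : 0 <= 2 * M / 2 ^+ n by rewrite divr_ge0 ?mulr_ge0 ?exprn_ge0.
  by rewrite /a /b; lra.
have abmn m n : a m <= b n.
  apply: (@le_trans _ _ (a (maxn m n))); first by apply: a_nd; rewrite leq_maxl.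
  by apply: (le_trans (ab _)); apply: b_ni; rewrite leq_maxr.
have hs : has_sup (range a).
  split; first by exists (a 0%N), 0%N.
  by exists (b 0%N) => _ [m _ <-].
exists (sup (range a)) => n.
have h1 : a n <= sup (range a) by apply: ub_le_sup; [case: hs|exists n].
have h2 : sup (range a) <= b n by apply: ge_sup; [case: hs|move=> _ [m _ <-]].
by rewrite ler_norml; move: h1 h2; rewrite /a /b; lra.
Qed.

End GeometricLimit.

(** * Delay differential equations with bounded Lipschitz right-hand side *)

Section Growth.
Context {R : realType}.

Lemma is_derive_expRM (K s : R) :
  is_derive s 1 (fun x => expR (K * x)) (K * expR (K * s)).
Proof.
have h : is_derive s 1 (fun x : R => K * x) (K * 1).
  exact: (@is_deriveZ _ _ _ id K s 1 1 (is_derive_id _ _)).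
have := @is_derive1_comp _ expR (fun x : R => K * x) s _ _ (is_derive_expR _) h.
by rewrite mulr1 mulrC.
Qed.

Lemma continuous_expRM (K : R) : continuous (fun x : R => expR (K * x)).
Proof. by move=> x; exact: is_derive_continuous (is_derive_expRM K x). Qed.

(** Comparison of [f] and [- f] with [C exp (K t)], whose derivative dominates
    theirs and whose value at zero is nonnegative. *)
Lemma exp_growth_bound (f df : R -> R) (C K t : R) : 0 <= t -> 0 <= C -> f 0 = 0 ->
  (forall s, 0 < s < t -> is_derive s 1 f (df s)) ->
  (forall s, 0 < s < t -> `|df s| <= C * (K * expR (K * s))) ->
  {within `[0, t], continuous f} -> `|f t| <= C * expR (K * t).
Proof.
wlog suff H : f df / (forall s, 0 < s < t -> is_derive s 1 f (df s)) ->
    0 <= t -> 0 <= C -> f 0 = 0 ->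
  (forall s, 0 < s < t -> `|df s| <= C * (K * expR (K * s))) ->
  {within `[0, t], continuous f} -> f t <= C * expR (K * t).
  move=> t0 C0 f0 fd fb fc; rewrite ler_norml; apply/andP; split; last exact: (H _ df).
  rewrite lerNl; apply: (H (fun x => - f x) (fun x => - df x)) => //.
  - by move=> s /fd; exact: is_deriveN.
  - by rewrite f0 oppr0.
  - by move=> s /fb; rewrite normrN.
  - by move=> x; apply: continuousN; exact: fc.
move=> fd t0 C0 f0 fb fc.
have : C * expR (K * 0) - f 0 <= C * expR (K * t) - f t.
  apply: (@nondecreasing_of_is_derive _ (fun s => C * expR (K * s) - f s)
    (fun s => C * (K * expR (K * s)) - df s) 0 t t0).
  - move=> s st; apply: is_deriveB; last exact: fd.
    exact: (@is_deriveZ _ _ _ _ C s 1 _ (is_derive_expRM _ _)).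
  - move=> s st; have := fb _ st; rewrite ler_norml => /andP[_]; lra.
  - move=> x; apply: cvgB; last exact: fc.
    apply: (@continuous_subspaceT _ _ _ (fun s => C * expR (K * s))) => y.
    by apply: cvgM; [exact: cvg_cst|exact: continuous_expRM].
by rewrite f0 mulr0 expR0; lra.
Qed.

End Growth.

Section DelayEquation.
Context {R : realType} {I : finType}.
Implicit Types (X Y : I -> R -> R) (i : I) (s t M : R) (n : nat).
Local Notation mu := (@lebesgue_measure R).
Variables (G : I -> (I -> R) -> (I -> R) -> R) (L B tau : R) (phi : I -> R -> R).
Hypothesis L0 : 0 < L.
Hypothesis tau0 : 0 <= tau.
(* Lipschitz for the sup norm over [I], phrased without forming the norm. *)
Hypothesis G_lip : forall i a b a' b' (m : R),
  (forall j, `|a j - a' j| <= m) -> (forall j, `|b j - b' j| <= m) ->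
  `|G i a b - G i a' b'| <= L * m.
Hypothesis G_bnd : forall i a b, `|G i a b| <= B.
Hypothesis phi_cont : forall i, continuous (phi i).

Let rhs (X : I -> R -> R) i (s : R) := G i (X^~ s) (X^~ (s - tau)).

Let picard (X : I -> R -> R) i (t : R) : R :=
  phi i (Num.min t 0) + \int[mu]_(s in `[0, t]) rhs X i s.

Let rhs_cont X : (forall i, continuous (X i)) -> forall i, continuous (rhs X i).
Proof.
move=> cX i t; apply/cvgrPdist_le => e e0; near=> s.
apply: (@le_trans _ _ (L * (e / L))); last by rewrite mulrC divfK// gt_eqF.
apply: G_lip.
  near: s; apply: filter_forall => j.
  by move/cvgrPdist_le : (cX j t); apply; rewrite divr_gt0.
near: s; apply: filter_forall => j.
have : {for t, continuous (fun s => X j (s - tau))}.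
  apply: (@continuous_comp _ _ _ (fun s => s - tau)); last exact: cX.
  by apply: continuousB; [exact: cvg_id|exact: cvg_cst].
by move/cvgrPdist_le; apply; rewrite divr_gt0.
Unshelve. all: by end_near. Qed.

Let picard_past X : (forall i, continuous (X i)) ->
  forall i t, t <= 0 -> picard X i t = phi i t.
Proof.
move=> cX i t t0; have [J0 _ _] := @primitive_from0 _ _ (rhs_cont X cX i).
by rewrite /picard J0// addr0 min_l.
Qed.

Let picard_derive X : (forall i, continuous (X i)) ->
  forall i t, 0 < t -> is_derive t 1 (picard X i) (rhs X i t).
Proof.
move=> cX i t t0; have [_ _ /(_ t t0) Jd] := @primitive_from0 _ _ (rhs_cont X cX i).
have : is_derive t 1 (fun x => phi i 0 + \int[mu]_(s in `[0, x]) rhs X i s) (0 + rhs X i t).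
  by apply: is_deriveD.
rewrite add0r; apply: near_eq_is_derive.
near=> s; rewrite /picard min_r//; apply: ltW; near: s; exact: lt_nbhsr.
Unshelve. all: by end_near. Qed.

Let picard_cont X : (forall i, continuous (X i)) -> forall i, continuous (picard X i).
Proof.
move=> cX i; have [_ cJ _] := @primitive_from0 _ _ (rhs_cont X cX i).
move=> t; apply: cvgD; last exact: cJ.
apply: (@continuous_comp _ _ _ (fun s : R => Num.min s 0) (phi i)); last first.
  exact: phi_cont.
by apply: continuous_min; [exact: cvg_id|exact: cvg_cst].
Qed.

(** For the weight [exp (2 L t)] the iteration halves distances: a difference of
    size [M exp (2 L s)] changes the right-hand side by [L M exp (2 L s)] at most,
    and integration divides by [2 L].  The delayed argument costs nothing because
    the weight increases. *)
Let picard_contract X Y M : (forall i, continuous (X i)) -> (forall i, continuous (Y i)) ->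
  (forall i t, `|X i t - Y i t| <= M * expR (2 * L * t)) ->
  forall i t, `|picard X i t - picard Y i t| <= M / 2 * expR (2 * L * t).
Proof.
move=> cX cY XY i t.
have M0 : 0 <= M by have := XY i 0; rewrite mulr0 expR0 mulr1; apply: le_trans.
have [t0|/ltW t0] := leP t 0.
  by rewrite !picard_past// subrr normr0 mulr_ge0 ?expR_ge0// divr_ge0.
apply: (@exp_growth_bound _ (fun t => picard X i t - picard Y i t)
  (fun t => rhs X i t - rhs Y i t)) => //.
- by rewrite divr_ge0.
- by rewrite !picard_past// subrr.
- by move=> s /andP[s0 _]; apply: is_deriveB; exact: picard_derive.
- move=> s _; apply: (le_trans (G_lip _ _ _ _ _ (M * expR (2 * L * s)) _ _)).
  + by move=> j; exact: XY.
  + move=> j; apply: (le_trans (XY _ _)); apply: ler_wpM2l => //.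
    rewrite ler_expR; apply: ler_wpM2l; first by rewrite mulr_ge0// ltW.
    by rewrite lerBlDr lerDl.
  + by rewrite le_eqVlt; apply/orP; left; apply/eqP; field.
- by apply: continuous_subspaceT => s; apply: continuousB; exact: picard_cont.
Qed.

Let iterate n := iter n picard (fun i t => phi i (Num.min t 0)).

Let iterate_cont n i : continuous (iterate n i).
Proof.
elim: n i => [|n IH] i; last exact: picard_cont.
move=> t; apply: (@continuous_comp _ _ _ (fun s : R => Num.min s 0) (phi i)); last first.
  exact: phi_cont.
by apply: continuous_min; [exact: cvg_id|exact: cvg_cst].
Qed.

Let B0 (i : I) : 0 <= B.
Proof. by have := G_bnd i (fun=> 0) (fun=> 0); apply: le_trans. Qed.

Let M0 := B / (2 * L).

Let iterate_step n i t :
  `|iterate n.+1 i t - iterate n i t| <= M0 / 2 ^+ n * expR (2 * L * t).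
Proof.
have M00 (j : I) : 0 <= M0 by apply: divr_ge0; [exact: (B0 j)|exact: mulr_ge0 (ltW L0)].
elim: n i t => [|n IH] i t; last first.
  rewrite exprSr invfM mulrA; apply: (picard_contract (iterate n.+1) (iterate n)).
  - exact: iterate_cont.
  - exact: iterate_cont.
  - exact: IH.
rewrite expr0 divr1.
have [t0|/ltW t0] := leP t 0.
  rewrite /= picard_past//; last exact: (iterate_cont 0).
  by rewrite min_l// subrr normr0 mulr_ge0 ?expR_ge0// (M00 i).
rewrite /= /picard [X in X - _]addrC addrK.
have [J0 cJ Jd] := @primitive_from0 _ _ (rhs_cont _ (iterate_cont 0) i).
apply: (@exp_growth_bound _ (fun x => \int[mu]_(s in `[0, x]) rhs (iterate 0) i s)
  (rhs (iterate 0) i)) => //.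
- exact: (M00 i).
- exact: J0.
- by move=> s /andP[s0 _]; exact: Jd.
- move=> s /andP[s0 _]; apply: (le_trans (G_bnd _ _ _)).
  rewrite mulrA /M0 divfK; last by rewrite gt_eqF// mulr_gt0.
  rewrite ler_peMr ?(B0 i)//; apply: le_trans (expR_ge1Dx _).
  by rewrite lerDl !mulr_ge0// ltW.
- exact: continuous_subspaceT.
Qed.

(** The weighted contraction gives a solution on the whole half-line at once,
    without a step-by-step extension over intervals of length [tau]. *)
Theorem delay_equation_exists : exists X : I -> R -> R,
  [/\ forall i, continuous (X i), forall i t, t <= 0 -> X i t = phi i t &
      forall i t, 0 < t -> is_derive t 1 (X i) (G i (X^~ t) (X^~ (t - tau)))].
Proof.
have /= lims i t : exists l, forall n,
    `|l - iterate n i t| <= 2 * (M0 * expR (2 * L * t)) / 2 ^+ n.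
  apply: geometric_sequence_limit => n; apply: (le_trans (iterate_step n i t)).
  by rewrite mulrAC.
pose X i t := sval (cid (lims i t)).
have XP i t n : `|X i t - iterate n i t| <= 2 * M0 / 2 ^+ n * expR (2 * L * t).
  have := svalP (cid (lims i t)) n; rewrite -/(X i t).
  by rewrite mulrA mulrAC.
have small (C e : R) : 0 < e -> exists n, C / 2 ^+ n < e.
  move=> e0; have := @cvg_geometric R C 2^-1.
  rewrite ger0_norm ?invr_ge0// invf_lt1// ltr1n => /(_ isT).
  move=> /cvgrPdist_lt /(_ e e0)[n _ nP].
  exists n; have := nP n (leqnn n); rewrite /= sub0r normrN exprVn.
  by apply: le_lt_trans; rewrite ler_norm.
have Xc i : continuous (X i).
  move=> t; apply/cvgrPdist_lt => e e0.
  have [n nP] := small (2 * M0 * expR (2 * L * (t + 1))) (e / 3) (divr_gt0 e0 (ltr0Sn _ _)).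
  near=> s.
  have bound u : u < t + 1 -> `|X i u - iterate n i u| < e / 3.
    move=> ut; apply: le_lt_trans (XP i u n) _; apply: le_lt_trans nP.
    rewrite -mulrA [_^-1 * _]mulrC mulrA ler_pM2r ?invr_gt0 ?exprn_gt0//.
    apply: ler_wpM2l; first by rewrite mulr_ge0 ?divr_ge0 ?(B0 i) ?mulr_ge0// ltW.
    by rewrite ler_expR; apply: ler_wpM2l; [rewrite mulr_ge0// ltW|exact: ltW].
  have h1 : `|X i t - iterate n i t| < e / 3 by apply: bound; rewrite ltrDl.
  have h2 : `|X i s - iterate n i s| < e / 3.
    by apply: bound; near: s; apply: lt_nbhsl; rewrite ltrDl.
  have h3 : `|iterate n i t - iterate n i s| < e / 3.
    near: s; move/cvgrPdist_lt : (iterate_cont n i t); apply; exact: divr_gt0.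
  move: h1 h2 h3; rewrite !ltr_norml => /andP[? ?] /andP[? ?] /andP[? ?].
  by apply/andP; split; lra.
(* Both [X] and its image under [picard] are the limit of the iterates. *)
have fixX i t : X i t = picard X i t.
  apply/eqP; rewrite -subr_eq0 -normr_le0; apply/ler_addgt0Pl => e e0; rewrite addr0.
  have [n nP] := small (2 * M0 * expR (2 * L * t)) e e0.
  have h1 := XP i t n.+1.
  have /= h2 := picard_contract _ _ _ Xc (iterate_cont n) (fun i t => XP i t n) i t.
  have -> : X i t - picard X i t =
      (X i t - iterate n.+1 i t) - (picard X i t - picard (iterate n) i t).
    by rewrite /=; ring.
  apply: (le_trans (ler_normB _ _)); apply: le_trans (ltW nP).
  apply: (le_trans (lerD h1 h2)).
  by rewrite exprS le_eqVlt; apply/orP; left; apply/eqP; field; rewrite expf_neq0.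
exists X; split => // [i t t0|i t t0].
  by rewrite fixX picard_past.
have -> : X i = picard X i by apply/funext => s; exact: fixX.
exact: picard_derive.
Unshelve. all: by end_near. Qed.

End DelayEquation.

(** * The polar equations with a clamped radius *)

Section Clamp.
Context {R : realType}.
Implicit Types (a b x y : R).

Definition clamp a b x : R := Num.max a (Num.min x b).

Lemma clamp_itv a b x : a <= b -> a <= clamp a b x <= b.
Proof. by move=> ab; rewrite /clamp le_max lexx/= ge_max ab ge_min lexx orbT. Qed.

Lemma clamp_id a b x : a <= x <= b -> clamp a b x = x.
Proof. by case/andP=> ax xb; rewrite /clamp min_l// max_r. Qed.

Lemma clamp_lip a b x y : `|clamp a b x - clamp a b y| <= `|x - y|.
Proof.
wlog xy : x y / y <= x => [H|].
  have [/H//|/ltW/H] := leP y x; by rewrite distrC [leRHS]distrC.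
rewrite (ger0_norm (_ : 0 <= x - y)) ?subr_ge0//.
rewrite /clamp !minEle !maxEle ler_norml.
by case: (leP x b) => ?; case: (leP y b) => ?;
  [case: (leP a x) => ?; case: (leP a y) => ?|case: (leP a x) => ?; case: (leP a b) => ?
  |case: (leP a b) => ?; case: (leP a y) => ?|case: (leP a b) => ?];
  apply/andP; split; lra.
Qed.

Lemma continuous_clamp_comp (f : R -> R) a b : a <= b ->
  {within `[a, b], continuous f} -> continuous (fun x => f (clamp a b x)).
Proof.
move=> ab /within_itv_continuousP cf x; apply/cvgrPdist_lt => e e0.
have [d d0 dP] := cf _ (clamp_itv a b x ab) e e0.
near=> y; apply: dP; first exact: clamp_itv.
apply: le_lt_trans (clamp_lip _ _ _ _) _.
by near: y; exists d.
Unshelve. all: by end_near. Qed.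

Lemma ler_distM x y x' y' (A B m n : R) : `|x| <= A -> `|y'| <= B ->
  `|x - x'| <= m -> `|y - y'| <= n -> `|x * y - x' * y'| <= A * n + B * m.
Proof.
move=> xA yB xm yn.
have -> : x * y - x' * y' = x * (y - y') + y' * (x - x') by ring.
by apply: (le_trans (ler_normD _ _)); rewrite !normrM lerD// ler_pM.
Qed.

Lemma cos_lip x y : `|cos x - cos y| <= `|x - y|.
Proof.
wlog xy : x y / y <= x => [H|].
  have [/H//|/ltW/H] := leP y x; by rewrite distrC [leRHS]distrC.
rewrite (ger0_norm (_ : 0 <= x - y)) ?subr_ge0// -[leRHS]mul1r.
have h := @lipschitz_of_is_derive _ cos (fun z => - sin z) y x 1 xy; apply: h.
- by move=> z _; rewrite normrN sin_max.
- by apply: continuous_subspaceT; exact: continuous_cos.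
Qed.

Lemma sin_lip x y : `|sin x - sin y| <= `|x - y|.
Proof.
by have := cos_lip (x - pi / 2) (y - pi / 2); rewrite !cosBpihalf opprB addrA subrK.
Qed.

End Clamp.

Section TruncatedSystem.
Context {R : realType}.

Variables (M : R).
Hypothesis M0 : 0 < M.

Let c (x : R) := clamp (- M) M x.

Let c_bnd x : `|c x| <= M.
Proof. by rewrite ler_norml; apply: clamp_itv; move: M0; lra. Qed.

Let c_lip x y (m : R) : `|x - y| <= m -> `|c x - c y| <= m.
Proof. exact: le_trans (clamp_lip _ _ _ _). Qed.

(** The polar equations with the radius clamped, the component [true] being the
    radius and [false] the angle; clamping makes the field bounded and globally
    Lipschitz and changes nothing as long as the radius stays below [M]. *)
Definition truncated_field (i : bool) (a b : bool -> R) : R :=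
  if i then clamp (- M) M (a true) *
    (1 - clamp (- M) M (a true) * clamp (- M) M (b true) * cos (a false - b false))
  else 1 + clamp (- M) M (a true) * clamp (- M) M (b true) * sin (a false - b false).

Let prod_bnd x y (z : R) : `|z| <= 1 -> `|c x * c y * z| <= M * M * 1.
Proof. by move=> z1; rewrite !normrM !ler_pM ?mulr_ge0. Qed.

Lemma truncated_field_bnd i a b : `|truncated_field i a b| <= (1 + M) * (1 + M * M).
Proof.
have h x : `|x| <= M * M * 1 -> `|1 + x| <= 1 + M * M.
  by move=> hx; apply: (le_trans (ler_normD _ _)); rewrite normr1 lerD2l; lra.
case: i; rewrite /truncated_field.
  rewrite normrM; apply: ler_pM => //.
    by apply: (le_trans (c_bnd _)); lra.
  by apply: h; rewrite normrN; exact/prod_bnd/cos_max.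
apply: (le_trans (h _ _)); first exact/prod_bnd/sin_max.
by rewrite ler_peMl ?addr_ge0 ?mulr_ge0 ?(ltW M0)// lerDl ltW.
Qed.

Let prod_lip (s : R -> R) x y t x' y' t' m :
  (forall u, `|s u| <= 1) -> (forall u w, `|s u - s w| <= `|u - w|) ->
  `|x - x'| <= m -> `|y - y'| <= m -> `|t - t'| <= 2 * m ->
  `|c x * c y * s t - c x' * c y' * s t'| <= (2 * M + 2 * M ^+ 2) * m.
Proof.
move=> s1 slip xm ym tm.
have h1 : `|c x * c y - c x' * c y'| <= M * m + M * m.
  by apply: ler_distM; [exact: c_bnd|exact: c_bnd|exact: c_lip|exact: c_lip].
have h2 : `|c x * c y| <= M * M by rewrite normrM ler_pM.
apply: (le_trans (ler_distM _ _ _ _ _ _ _ _ h2 (s1 t') h1 (le_trans (slip _ _) tm))).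
by rewrite le_eqVlt; apply/orP; left; apply/eqP; ring.
Qed.

Lemma truncated_field_lip i a b a' b' (m : R) :
  (forall j, `|a j - a' j| <= m) -> (forall j, `|b j - b' j| <= m) ->
  `|truncated_field i a b - truncated_field i a' b'| <=
  (1 + 2 * M + 5 * M ^+ 2 + 2 * M ^+ 3) * m.
Proof.
move=> am bm.
have m0 : 0 <= m by exact: le_trans (am true).
have tm : `|(a false - b false) - (a' false - b' false)| <= 2 * m.
  have -> : a false - b false - (a' false - b' false) =
    (a false - a' false) - (b false - b' false) by ring.
  by apply: (le_trans (ler_normB _ _)); have := am false; have := bm false; lra.
have hs := prod_lip (@sin R) _ _ _ _ _ _ _ (@sin_max R) sin_lip (am true) (bm true) tm.
have hc := prod_lip (@cos R) _ _ _ _ _ _ _ (@cos_max R) cos_lip (am true) (bm true) tm.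
have M2 : 0 <= M ^+ 2 by rewrite exprn_ge0// ltW.
have M3 : 0 <= M ^+ 3 by rewrite exprn_ge0// ltW.
case: i; rewrite /truncated_field; last first.
  rewrite opprD addrACA subrr add0r; apply: (le_trans hs).
  by apply: ler_wpM2r => //; lra.
have h1 : `|(1 - c (a true) * c (b true) * cos (a false - b false)) -
            (1 - c (a' true) * c (b' true) * cos (a' false - b' false))| <=
          (2 * M + 2 * M ^+ 2) * m.
  rewrite -normrN; apply: le_trans hc.
  by rewrite le_eqVlt; apply/orP; left; apply/eqP; congr Num.norm; rewrite /c; ring.
have h2 : `|1 - c (a' true) * c (b' true) * cos (a' false - b' false)| <= 1 + M * M * 1.
  by apply: (le_trans (ler_normB _ _)); rewrite normr1 lerD2l; exact/prod_bnd/cos_max.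
apply: (le_trans (ler_distM _ _ _ _ _ _ _ _ (c_bnd _) h2 (c_lip _ _ _ (am true)) h1)).
rewrite -subr_ge0 [X in 0 <= X](_ : _ = (2 * M + 2 * M ^+ 2) * m); last by ring.
by rewrite mulr_ge0// addr_ge0 ?mulr_ge0// ltW.
Qed.

End TruncatedSystem.

Section TruncatedSolution.
Context {R : realType}.
Implicit Types s t T : R.
Local Notation mu := (@lebesgue_measure R).

(** The angle [th] of the truncated system starts from the integral of the given
    angular velocity, so its increments over the delay are the phases of the
    coupled system. *)
Lemma truncated_coupled_solution (M tau : R) (phi psi : R -> R) : 0 < M -> 0 < tau ->
  {within `[- tau, 0], continuous phi} ->
  mu.-integrable `[- tau, 0] (EFin \o psi) ->
  exists r v th : R -> R,
  [/\ continuous r /\ continuous th,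
      forall s, - tau <= s <= 0 ->
        [/\ r s = phi s, v s = psi s & th s = \int[mu]_(x in `[- tau, s]) psi x],
      forall t, 0 < t -> is_derive t 1 th (v t),
      forall t, 0 <= t ->
        \int[mu]_(s in `[t - tau, t]) v s = th t - th (t - tau) &
      forall T, 0 < T -> (forall t, - tau <= t < T -> `|r t| <= M) ->
        coupled_solution tau T r v].
Proof.
move=> M0 tau0 cphi ipsi.
have Nt0 : - tau <= 0 by rewrite oppr_le0 ltW.
pose past (i : bool) (s : R) : R :=
  if i then phi (clamp (- tau) 0 s) else \int[mu]_(x in `[- tau, clamp (- tau) 0 s]) psi x.
have past_cont i : continuous (past i).
  case: i; first exact: continuous_clamp_comp.
  apply: (@continuous_clamp_comp _ (fun s => \int[mu]_(x in `[- tau, s]) psi x)) => //.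
  exact: parameterized_integral_continuous.
pose L := 1 + 2 * M + 5 * M ^+ 2 + 2 * M ^+ 3.
have L0 : 0 < L.
  have M2 : 0 <= M ^+ 2 by rewrite exprn_ge0// ltW.
  have M3 : 0 <= M ^+ 3 by rewrite exprn_ge0// ltW.
  by rewrite /L; lra.
have [X [Xc Xpast Xd]] := @delay_equation_exists R bool (truncated_field M) L
  ((1 + M) * (1 + M * M)) tau past L0 (ltW tau0) (truncated_field_lip M M0)
  (truncated_field_bnd M M0) past_cont.
pose g s := truncated_field M false (X^~ s) (X^~ (s - tau)).
have Xcd i : continuous (fun s => X i (s - tau)).
  move=> t; apply: (@continuous_comp _ _ _ (fun s => s - tau)); last exact: Xc.
  by apply: continuousB; [exact: cvg_id|exact: cvg_cst].
have clamp_cont (f : R -> R) : continuous f -> continuous (fun s => clamp (- M) M (f s)).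
  move=> cf t; apply/cvgrPdist_lt => e e0; near=> s.
  apply: le_lt_trans (clamp_lip _ _ _ _) _.
  by near: s; move/cvgrPdist_lt : (cf t); apply.
have gc : continuous g.
  move=> t; rewrite /g /truncated_field; apply: cvgD; first exact: cvg_cst.
  apply: cvgM; first apply: cvgM.
  - exact: clamp_cont.
  - exact: (clamp_cont (fun s => X true (s - tau))).
  apply: (@continuous_comp _ _ _ (fun s => X false s - X false (s - tau)) sin).
    by apply: cvgB; [exact: Xc|exact: (Xcd false)].
  exact: continuous_sin.
pose v t := if t <= 0 then psi t else g t.
have vpast t : t <= 0 -> v t = psi t by rewrite /v => ->.
have vfut t : 0 < t -> v t = g t by rewrite /v ltNge => /negbTE ->.
have vint T : 0 <= T -> mu.-integrable `[- tau, T] (EFin \o v).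
  move=> T0; apply: (@integrable_itv_glue _ psi g _ _ 0) => //.
  exact: continuous_integrable_itv.
have thpast s : - tau <= s <= 0 -> X false s = \int[mu]_(x in `[- tau, s]) psi x.
  by move=> s0; rewrite Xpast ?(andP s0).2//= clamp_id.
have thd t : 0 < t -> is_derive t 1 (X false) (v t).
  by move=> t0; rewrite vfut//; exact: Xd.
have thE t : - tau <= t -> \int[mu]_(s in `[- tau, t]) v s = X false t.
  move=> tt; have [t0|/ltW t0] := leP t 0.
    rewrite thpast ?tt//; apply: eq_Rintegral => s; rewrite inE/= in_itv/= => /andP[_ st].
    by rewrite vpast// (le_trans st).
  rewrite (@Rintegral_itv_add _ _ _ 0)//; last exact: vint.
  have -> : \int[mu]_(s in `[0, t]) v s = X false t - X false 0.
    apply: (@Rintegral_derive _ _ _ g) => //.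
    - by apply: integrable_itv_sub (vint _ t0).
    - by move=> s /andP[s0 _]; exact: vfut.
    - by move=> s /andP[s0 _]; rewrite -vfut//; exact: thd.
    - exact: continuous_subspaceT.
  rewrite (thpast 0) ?lexx ?Nt0//.
  rewrite (@eq_Rintegral _ _ _ mu _ psi); first by rewrite addrC subrK.
  by move=> s; rewrite inE/= in_itv/= => /andP[_]; exact: vpast.
have phaseE t : 0 <= t ->
    \int[mu]_(s in `[t - tau, t]) v s = X false t - X false (t - tau).
  move=> t0; have tt : - tau <= t - tau by rewrite lerBrDr addNr.
  rewrite -(thE t) ?(le_trans Nt0)// -(thE (t - tau))//.
  rewrite (@Rintegral_itv_add _ v (- tau) (t - tau) t)//; last exact: vint.
    by rewrite addrAC subrr add0r.
  by rewrite lerBlDr lerDl ltW.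
exists (X true), v, (X false); split => //.
- move=> s s0; split; [|by rewrite vpast// (andP s0).2|exact: thpast].
  by rewrite Xpast ?(andP s0).2//= clamp_id.
- move=> T T0 rM; split; [exact: continuous_subspaceT|exact: vint (ltW T0)|].
  move=> t /andP[t0 tT] /=; rewrite phaseE ?ltW//.
  have c1 : clamp (- M) M (X true t) = X true t.
    by apply: clamp_id; rewrite -ler_norml; apply: rM; rewrite tT andbT; lra.
  have c2 : clamp (- M) M (X true (t - tau)) = X true (t - tau).
    by apply: clamp_id; rewrite -ler_norml; apply: rM; apply/andP; split; lra.
  split.
    by have := Xd true t t0; rewrite /truncated_field c1 c2.
  by rewrite vfut// /g /truncated_field c1 c2.
Unshelve. all: by end_near. Qed.

End TruncatedSolution.

(** * The coupled system relative to an equilibrium *)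

Section RelativeCoordinates.
Context {R : realType}.
Local Notation mu := (@lebesgue_measure R).
Implicit Types (a b d k m s t T x y : R).

(** The right-hand sides in the relative coordinates [a = r / rho - 1], its delayed
    value [b], and the phase deviation [d]; [k = omega - 1]. *)
Definition radial_field k a b d : R :=
  (1 + a) * (1 - (1 + a) * (1 + b) * (cos d - k * sin d)).

Definition angular_field k a b d : R :=
  - k + (1 + a) * (1 + b) * (k * cos d + sin d).

Section FieldBounds.
Variables (k a b d m : R).
Hypotheses (k_small : `|k| <= 20^-1) (m_small : m <= 100^-1).
Hypotheses (am : `|a| <= m) (bm : `|b| <= m) (dm : `|d| <= m).

Let m0 : 0 <= m. Proof. exact: le_trans am. Qed.

Let ab_bnd : `|a * b| <= 100^-1 * m.
Proof. by apply: ler_normM bm; exact: le_trans m_small. Qed.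

Let S_bnd : `|sin d| <= m. Proof. exact: le_trans (ler_norm_sin d) dm. Qed.

Let C_bnd : `|1 - cos d| <= 200^-1 * m.
Proof.
rewrite ger0_norm ?onem_cos_ge0//; apply: (le_trans (onem_cos_le d)).
rewrite -real_normK ?num_real//.
have : `|d| ^+ 2 <= 100^-1 * m.
  by rewrite expr2; apply: ler_pM => //; exact: le_trans m_small.
by lra.
Qed.

Let h_bnd : `|(1 + a) * (1 + b)| <= 103 / 100.
Proof.
have h x : `|x| <= m -> `|1 + x| <= 101 / 100.
  move=> xm; apply: (le_trans (ler_normD _ _)); rewrite normr1.
  by move: m_small; lra.
by apply: (le_trans (ler_normM _ _ _ _ (h _ am) (h _ bm))); lra.
Qed.

Let sum_bnd : `|a + b + a * b| <= 201 / 100 * m.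
Proof.
apply: (le_trans (ler_normD2 _ _ _ _ (ler_normD2 _ _ _ _ am bm) ab_bnd)).
by lra.
Qed.

Lemma angular_field_le : `|angular_field k a b d| <= 2 * m.
Proof.
have -> : angular_field k a b d = k * (a + b + a * b)
   + - (k * ((1 + a) * (1 + b) * (1 - cos d))) + (1 + a) * (1 + b) * sin d.
  by rewrite /angular_field; ring.
apply: (@le_trans _ _ (20^-1 * (201 / 100 * m) + 20^-1 * (103 / 100 * (200^-1 * m))
    + 103 / 100 * m)).
  apply: ler_normD2; last exact: ler_normM.
  apply: ler_normD2; first exact: ler_normM.
  by rewrite normrN; apply: ler_normM => //; exact: ler_normM.
by move: m0; lra.
Qed.

(** The phase deviation enters the linear part only with the factor [k], so up to
    terms that are quadratic or of order [k m] the field is [- a - b]. *)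
Lemma radial_field_linearization : `|radial_field k a b d + a + b| <= 8^-1 * m.
Proof.
have -> : radial_field k a b d + a + b = - (a * b) + - (a * (a + b + a * b))
   + (1 + a) * ((1 + a) * (1 + b)) * ((1 - cos d) + k * sin d).
  by rewrite /radial_field; ring.
have a1 : `|1 + a| <= 101 / 100.
  apply: (le_trans (ler_normD _ _)); rewrite normr1.
  by move: am m_small; lra.
apply: (@le_trans _ _ (100^-1 * m + 100^-1 * (201 / 100 * m)
    + (101 / 100) * (103 / 100) * (200^-1 * m + 20^-1 * m))).
  apply: ler_normD2; last first.
    by apply: ler_normM; [exact: ler_normM|apply: ler_normD2 => //; exact: ler_normM].
  apply: ler_normD2; rewrite normrN//; apply: ler_normM => //.
  exact: le_trans m_small.
by move: m0; lra.
Qed.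

Lemma radial_field_le : `|radial_field k a b d| <= 3 * m.
Proof.
have -> : radial_field k a b d = (radial_field k a b d + a + b) + - (a + b) by ring.
apply: (le_trans (ler_normD2 _ _ _ _ radial_field_linearization (_ : _ <= m + m))).
  by rewrite normrN; exact: ler_normD2.
by move: m0; lra.
Qed.

End FieldBounds.

Section RelativeEquations.
Variables (tau rho omega : R).
Hypotheses (tau0 : 0 < tau) (rho0 : 0 < rho).
Hypothesis rho_cos : rho ^+ 2 * cos (omega * tau) = 1.
Hypothesis rho_sin : omega = 1 + rho ^+ 2 * sin (omega * tau).

(** Adding [D] to the phase [omega tau] of the equilibrium turns
    [rho^2 (cos, sin)] into [(cos D - k sin D, k cos D + sin D)], because
    [rho^2 cos (omega tau) = 1] and [rho^2 sin (omega tau) = k]. *)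
Lemma coupled_solution_relative T (r v : R -> R) t :
  coupled_solution tau T r v -> 0 < t < T ->
  let u s := r s / rho - 1 in
  let D := \int[mu]_(s in `[t - tau, t]) (v s - omega) in
  is_derive t 1 u (radial_field (omega - 1) (u t) (u (t - tau)) D) /\
  v t - omega = angular_field (omega - 1) (u t) (u (t - tau)) D.
Proof.
move=> [cr iv eqs] tT u D; have /= [rd vE] := eqs t tT.
have [t0 tT'] := andP tT.
have rhoN0 : rho != 0 by rewrite gt_eqF.
have ivt : mu.-integrable `[t - tau, t] (EFin \o v).
  by apply: integrable_itv_sub iv; [lra|exact: ltW].
have phaseE : \int[mu]_(s in `[t - tau, t]) v s = omega * tau + D.
  rewrite /D RintegralB//; last first.
    by apply: continuous_integrable_itv => x; exact: cvg_cst.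
  have tt : t - tau <= t by rewrite lerBlDr lerDl ltW.
  rewrite Rintegral_itv_cst//.
  have -> : omega * (t - (t - tau)) = omega * tau by ring.
  by rewrite addrCA subrr addr0.
have rE s : r s = rho * (1 + u s) by rewrite /u; field.
have ks : rho ^+ 2 * sin (omega * tau) = omega - 1 by rewrite [in RHS]rho_sin addrC addKr.
have cE : rho ^+ 2 * cos (omega * tau + D) = cos D - (omega - 1) * sin D.
  by rewrite cosD mulrBr !mulrA rho_cos ks mul1r.
have sE : rho ^+ 2 * sin (omega * tau + D) = (omega - 1) * cos D + sin D.
  by rewrite sinD mulrDr !mulrA rho_cos ks mul1r.
rewrite phaseE in rd vE.
split.
  have : is_derive t 1 (fun s => rho^-1 * r s - 1)
     (rho^-1 * (r t * (1 - r t * r (t - tau) * cos (omega * tau + D))) - 0).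
    apply: is_deriveB; exact: (@is_deriveZ _ _ _ r rho^-1 t 1 _ rd).
  have -> : (fun s => rho^-1 * r s - 1) = u by apply/funext => s; rewrite /u mulrC.
  move/is_derive_eq; apply; rewrite subr0 [in LHS]rE [in LHS](rE (t - tau)).
  rewrite [LHS](_ : _ = (1 + u t) * (1 - (1 + u t) * (1 + u (t - tau)) *
    (rho ^+ 2 * cos (omega * tau + D)))); last by field.
  by rewrite cE.
rewrite vE rE (rE (t - tau)).
rewrite [LHS](_ : _ = 1 - omega + (1 + u t) * (1 + u (t - tau)) *
    (rho ^+ 2 * sin (omega * tau + D))); last by ring.
by rewrite sE /angular_field opprB.
Qed.

End RelativeEquations.
End RelativeCoordinates.

(** * Exponential decay for short delays *)

Section Decay.
Context {R : realType}.
Local Notation mu := (@lebesgue_measure R).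
Implicit Types (s t T x y : R).

Lemma continuous_window_integral (f : R -> R) (tau T : R) : 0 <= tau -> 0 <= T ->
  mu.-integrable `[- tau, T] (EFin \o f) ->
  {within `[0, T], continuous (fun t => \int[mu]_(s in `[t - tau, t]) f s)}.
Proof.
move=> tau0 T0 fi.
pose A t := \int[mu]_(s in `[- tau, t]) f s.
have NtT : - tau <= T by apply: le_trans T0; rewrite oppr_le0.
have cA : {within `[- tau, T], continuous A} by exact: parameterized_integral_continuous.
have WE t : 0 <= t <= T -> \int[mu]_(s in `[t - tau, t]) f s = A t - A (t - tau).
  move=> /andP[t0 tT]; rewrite /A (@Rintegral_itv_add _ _ (- tau) (t - tau) t); try lra.
  by apply: integrable_itv_sub fi.
move/within_itv_continuousP : cA => cA; apply/within_itv_continuousP => x x0T e e0.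
have xi : - tau <= x <= T by lra.
have xi' : - tau <= x - tau <= T by lra.
have e2 : 0 < e / 2 by rewrite divr_gt0.
have [d1 d10 d1P] := cA _ xi _ e2.
have [d2 d20 d2P] := cA _ xi' _ e2.
exists (Num.min d1 d2); first by rewrite lt_min d10.
move=> y y0T; rewrite lt_min => /andP[xy1 xy2].
rewrite !WE//.
have h1 : `|A x - A y| < e / 2 by apply: d1P => //; lra.
have h2 : `|A (x - tau) - A (y - tau)| < e / 2.
  apply: d2P; first by lra.
  by have -> : x - tau - (y - tau) = x - y by ring.
move: h1 h2; rewrite !ltr_norml => h1 h2; lra.
Qed.

Section SmallDelay.
Variables (tau rho omega delta T : R) (r v : R -> R).
Hypotheses (tau0 : 0 < tau) (tau_small : tau <= 100^-1) (rho0 : 0 < rho).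
Hypothesis rho_cos : rho ^+ 2 * cos (omega * tau) = 1.
Hypothesis rho_sin : omega = 1 + rho ^+ 2 * sin (omega * tau).
Hypothesis k_small : `|omega - 1| <= 20^-1.
Hypotheses (delta0 : 0 < delta) (delta_small : delta <= 1000^-1).
Hypotheses (T0 : 0 < T) (sol : coupled_solution tau T r v).

Let u s := r s / rho - 1.
Let W t := \int[mu]_(s in `[t - tau, t]) `|v s - omega|.
Hypothesis u_past : forall s, - tau <= s <= 0 -> `|u s| <= delta.
Hypothesis W_past : W 0 <= delta.

(** The barrier: it starts at twice the size of the history, and its rate 1/4 is
    well below the linear rate 2, which leaves room for the error terms. *)
Let y s := 2 * delta * expR (- 4^-1 * s).

Let y_gt0 s : 0 < y s.
Proof. by rewrite /y mulr_gt0 ?expR_gt0// mulr_gt0. Qed.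

Let y_nincr s t : s <= t -> y t <= y s.
Proof.
move=> st; rewrite /y; apply: ler_wpM2l; first by rewrite mulr_ge0// ltW.
by rewrite ler_expR; lra.
Qed.

Let y0 : y 0 = 2 * delta. Proof. by rewrite /y mulr0 expR0 mulr1. Qed.

Let y_delay s : y (s - tau) <= 101 / 100 * y s.
Proof.
rewrite /y mulrBr expRD mulrA [leRHS]mulrC.
apply: ler_wpM2l; first exact: ltW (y_gt0 s).
rewrite mulNr opprK -[_ * tau]opprK expRN -mulNr.
have h : 1 - 400^-1 <= expR (- 4^-1 * tau).
  by apply: le_trans (expR_ge1Dx _); move: tau_small; lra.
rewrite invf_ple ?posrE ?expR_gt0//; last by lra.
Qed.

Let iw0 : mu.-integrable `[- tau, T] (EFin \o (fun s => v s - omega)).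
Proof.
case: sol => _ iv _.
have ic : mu.-integrable `[- tau, T] (EFin \o cst omega).
  by apply: continuous_integrable_itv => x; exact: cvg_cst.
exact: (@integrableB _ _ _ mu _ (measurable_itv _) (EFin \o v) (EFin \o cst omega)).
Qed.

Let iw : mu.-integrable `[- tau, T] (EFin \o (fun s => `|v s - omega|)).
Proof. exact: (@integrable_norm _ _ _ mu _ (fun s => v s - omega)). Qed.

Let u_cont : {within `[- tau, T], continuous u}.
Proof.
case: sol => cr _ _ x; apply: cvgB; last exact: cvg_cst.
by apply: cvgM; [exact: cr|exact: cvg_cst].
Qed.

Let W_cont : {within `[0, T], continuous W}.
Proof. by apply: continuous_window_integral => //; exact: ltW. Qed.

(** One step of the continuous induction: the bounds up to time [t] improve to
    strict bounds at time [t]. *)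
Section Step.
Variable t : R.
Hypothesis t0T : 0 < t <= T.
Hypothesis u_lt : forall s, 0 <= s < t -> `|u s| < y s.
Hypothesis W_lt : forall s, 0 <= s < t -> W s < y s.

Let u_le s : - tau <= s -> s < t -> `|u s| <= y s.
Proof.
move=> ts st; have [s0|s0] := leP 0 s; first by apply/ltW/u_lt; rewrite s0.
apply: (@le_trans _ _ delta); first by apply: u_past; rewrite ts ltW.
apply: le_trans (y_nincr _ _ (ltW s0)); rewrite y0; move: delta0; lra.
Qed.

(* A bound of the barrier over the whole delay before [s], by [y_delay]. *)
Let m s := 101 / 100 * y s.

Let D s := \int[mu]_(x in `[s - tau, s]) (v x - omega).

Let fields_small s : 0 < s < t ->
  [/\ m s <= 100^-1, `|u s| <= m s, `|u (s - tau)| <= m s & `|D s| <= m s].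
Proof.
move=> /andP[s0 st]; have ys := y_gt0 s.
have ym : y s <= m s by rewrite /m; lra.
split.
- rewrite /m; have := y_nincr _ _ (ltW s0); rewrite y0; move: delta_small; lra.
- apply: le_trans ym; apply: u_le => //; move: tau0; lra.
- apply: le_trans (y_delay s); apply: u_le; move: tau0; lra.
- apply: le_trans ym; apply: (@le_trans _ _ (W s)).
    apply: le_normr_Rintegral => //; apply: integrable_itv_sub iw0; move: t0T tau0; lra.
  by apply/ltW/W_lt; rewrite (ltW s0).
Qed.

Let u_derive s : 0 < s < t ->
  is_derive s 1 u (radial_field (omega - 1) (u s) (u (s - tau)) (D s)).
Proof.
move=> s0t; have sT : 0 < s < T by move: t0T s0t; lra.
by have [] := coupled_solution_relative tau rho omega tau0 rho0
  rho_cos rho_sin T r v s sol sT.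
Qed.

Let w_le s : 0 < s < t -> `|v s - omega| <= 2 * m s.
Proof.
move=> s0t; have sT : 0 < s < T by move: t0T s0t; lra.
have [_ ->] := coupled_solution_relative tau rho omega tau0 rho0
  rho_cos rho_sin T r v s sol sT.
by have [m1 um utm Dm] := fields_small _ s0t; exact: angular_field_le.
Qed.

(** Beyond the history, which contributes at most [delta] and only before time
    [tau], the window integral gains at most the short length [tau] times the
    size of the recent past. *)
Let W_step : W t < y t.
Proof.
have [t0 tT] := andP t0T.
have [tle|tgt] := leP t tau.
  have -> : W t = \int[mu]_(s in `[t - tau, 0]) `|v s - omega| +
                  \int[mu]_(s in `[0, t]) `|v s - omega|.
    rewrite /W; apply: Rintegral_itv_add; [by lra|exact: ltW|].
    by apply: integrable_itv_sub iw => //; lra.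
  have h1 : \int[mu]_(s in `[t - tau, 0]) `|v s - omega| <= delta.
    apply: le_trans W_past; rewrite /W sub0r.
    rewrite [leRHS](@Rintegral_itv_add _ _ _ (t - tau)); [|lra|lra|].
      by rewrite lerDr; apply: Rintegral_ge0.
    by apply: integrable_itv_sub iw => //; exact: ltW.
  have h2 : \int[mu]_(s in `[0, t]) `|v s - omega| <= 2 * (101 / 100 * y 0) * (t - 0).
    apply: le_Rintegral_itv; first exact: ltW.
      by apply: integrable_itv_sub iw => //; move: tau0; lra.
    move=> s s0t; apply: (le_trans (w_le s s0t)); rewrite /m.
    by have := y_nincr 0 s (ltW (andP s0t).1); lra.
  have yt : 2 * delta <= 101 / 100 * y t.
    rewrite -y0; apply: le_trans (y_delay t).
    by apply: y_nincr; lra.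
  have : 2 * (101 / 100 * y 0) * (t - 0) <= 2 * (101 / 100 * y 0) * 100^-1.
    by apply: ler_wpM2l; [rewrite y0; move: delta0; lra|move: tau_small; lra].
  by move: h1 h2 yt; rewrite y0; move: delta0; lra.
have h : W t <= 2 * (101 / 100 * y (t - tau)) * (t - (t - tau)).
  apply: le_Rintegral_itv; first by move: tau0; lra.
    by apply: integrable_itv_sub iw => //; move: tau0; lra.
  move=> s /andP[s1 s2]; apply: (le_trans (w_le s _)); first by lra.
  by rewrite /m; have := y_nincr _ _ (ltW s1); lra.
apply: (le_lt_trans h).
have -> : t - (t - tau) = tau by ring.
have yt := y_delay t.
apply: (@le_lt_trans _ _ (2 * (101 / 100 * (101 / 100 * y t)) * 100^-1)).
  apply: ler_pM => //.
  - by have := y_gt0 (t - tau); lra.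
  - exact: ltW.
  - by lra.
by have := y_gt0 t; lra.
Qed.

(** Up to time [tau] the delayed value belongs to the history, bounded by [delta],
    about half of the barrier; later the mean value theorem applies. *)
Let delay_change s : 0 < s < t -> `|u s - u (s - tau)| <= 3 / 2 * y s + 100^-1 * y s.
Proof.
move=> s0t; have [s0 st] := andP s0t.
have [sle|sgt] := leP s tau.
  have h1 : `|u s| <= y s by apply: u_le => //; move: tau0; lra.
  have h2 : `|u (s - tau)| <= delta by apply: u_past; lra.
  have yt : 2 * delta <= 101 / 100 * y s.
    by rewrite -y0; apply: le_trans (y_delay s); apply: y_nincr; lra.
  by apply: (le_trans (ler_normB _ _)); move: delta0; lra.
have ss : s - tau <= s by rewrite lerBlDr lerDl ltW.
have h := @lipschitz_of_is_derive _ u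
  (fun x => radial_field (omega - 1) (u x) (u (x - tau)) (D x))
  (s - tau) s (3 * (101 / 100 * y (s - tau))) ss.
apply: (@le_trans _ _ (3 * (101 / 100 * y (s - tau)) * (s - (s - tau)))).
  apply: h.
  - by move=> x xs; apply: u_derive; lra.
  - move=> x xs; have xt : 0 < x < t by lra.
    have [m1 um utm Dm] := fields_small _ xt.
    apply: (le_trans (radial_field_le _ _ _ _ _ k_small m1 um utm Dm)).
    by rewrite /m; have := y_nincr _ _ (ltW (andP xs).1); lra.
  - apply: continuous_subspaceW u_cont; apply: subset_itv; rewrite bnd_simp.
      by move: tau0; lra.
    by move: t0T; lra.
have -> : s - (s - tau) = tau by ring.
have ys := y_delay s; have ys0 := y_gt0 s; have ys1 := y_gt0 (s - tau).
apply: (@le_trans _ _ (3 * (101 / 100 * (101 / 100 * y s)) * 100^-1)); last by lra.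
by apply: ler_pM => //; [lra|exact: ltW|lra].
Qed.

(** Written as [u' = - 2 u + (u - u_tau) + error], the radial equation makes
    [exp (2 s) (y s - sg u s)] nondecreasing: its derivative is nonnegative as soon
    as the last two terms stay below [7/4 y]. *)
Let u_step (sg : R) : sg = 1 \/ sg = -1 -> sg * u t < y t.
Proof.
move=> sgE; have [t0 tT] := andP t0T.
have sg1 : `|sg| = 1 by case: sgE => ->; rewrite ?normrN normr1.
have normsg x : sg * x <= `|x|.
  by apply: (le_trans (ler_norm _)); rewrite normrM sg1 mul1r.
pose Phi s := 2 * delta * expR (7 / 4 * s) - sg * (expR (2 * s) * u s).
have expE s : 2 * delta * expR (7 / 4 * s) = expR (2 * s) * y s.
  rewrite /y mulrCA -expRD; congr (_ * expR _); lra.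
have mono : Phi 0 <= Phi t.
  apply: (@nondecreasing_of_is_derive _ Phi
    (fun s => 2 * delta * (7 / 4 * expR (7 / 4 * s))
    - sg * (expR (2 * s) * radial_field (omega - 1) (u s) (u (s - tau)) (D s)
           + u s * (2 * expR (2 * s)))) 0 t (ltW t0)).
  - move=> s s0t; apply: is_deriveB.
      exact: (@is_deriveZ _ _ _ _ (2 * delta) s 1 _ (is_derive_expRM _ _)).
    apply: (@is_deriveZ _ _ _ (fun s => expR (2 * s) * u s) sg s 1 _ _).
    exact: (@is_deriveM _ _ _ _ _ _ _ _ (is_derive_expRM _ _) (u_derive s s0t)).
  - move=> s s0t; set F := radial_field _ _ _ _.
    have [m1 um utm Dm] := fields_small _ s0t.
    have hE : `|F + u s + u (s - tau)| <= 8^-1 * m s by exact: radial_field_linearization.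
    have hd := delay_change s s0t.
    have -> : 2 * delta * (7 / 4 * expR (7 / 4 * s)) -
       sg * (expR (2 * s) * F + u s * (2 * expR (2 * s))) =
       expR (2 * s) * (7 / 4 * y s -
         (sg * (F + u s + u (s - tau)) + sg * (u s - u (s - tau)))).
      have := expE s; set E1 := expR (7 / 4 * s); set E2 := expR (2 * s) => e12.
      rewrite [2 * delta * _](_ : _ = 7 / 4 * (2 * delta * E1)); last by ring.
      by rewrite e12; ring.
    rewrite mulr_ge0 ?expR_ge0// subr_ge0.
    apply: (le_trans (lerD (normsg _) (normsg _))).
    by have := y_gt0 s; move: hE hd; rewrite /m; lra.
  - move=> x; apply: cvgB.
      apply: (@continuous_subspaceT _ _ _ (fun s => 2 * delta * expR (7 / 4 * s))) => z.
      by apply: cvgM; [exact: cvg_cst|exact: continuous_expRM].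
    apply: cvgM; first exact: cvg_cst.
    apply: cvgM; first by apply: continuous_subspaceT; exact: continuous_expRM.
    move: x; apply: continuous_subspaceW u_cont; apply: subset_itv; rewrite bnd_simp//.
    by rewrite oppr_le0 ltW.
have Phi0 : 0 < Phi 0.
  rewrite /Phi !mulr0 expR0 mulr1 mul1r subr_gt0.
  apply: (le_lt_trans (normsg _)).
  have : `|u 0| <= delta by apply: u_past; move: tau0; lra.
  by move: delta0; lra.
have := lt_le_trans Phi0 mono; rewrite /Phi expE subr_gt0 mulrCA.
by rewrite ltr_pM2l ?expR_gt0.
Qed.

Lemma decay_step : `|u t| < y t /\ W t < y t.
Proof.
split; last exact: W_step.
rewrite ltr_norml; apply/andP; split.
  by have := u_step (-1) (or_intror erefl); rewrite mulN1r ltrNl.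
by have := u_step 1 (or_introl erefl); rewrite mul1r.
Qed.

End Step.

(** Stability and attraction in one estimate, valid for solutions on a bounded
    interval, so that it also serves to exclude a blow-up. *)
Lemma exponential_decay t : 0 <= t <= T -> `|u t| < y t /\ W t < y t.
Proof.
move=> t0T.
pose f s := Num.min (y s - `|u s|) (y s - W s).
suff : 0 < f t by rewrite /f lt_min !subr_gt0 => /andP[].
move: t t0T; apply: positive_by_continuity.
  have cy : {within `[0, T], continuous y}.
    apply: continuous_subspaceT => z.
    by apply: cvgM; [exact: cvg_cst|exact: continuous_expRM].
  move=> x; apply: (@continuous_min _ (subspace `[0, T]) (fun s => y s - `|u s|)
    (fun s => y s - W s)).
    apply: cvgB; first exact: cy.
    apply: cvg_norm; move: x; apply: continuous_subspaceW u_cont.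
    apply: subset_itv; rewrite bnd_simp//.
    by rewrite oppr_le0 ltW.
  by apply: cvgB; [exact: cy|exact: W_cont].
move=> t /andP[]; rewrite le_eqVlt => /predU1P[<- _ _|t0 tT H].
  rewrite /f lt_min !subr_gt0 y0; apply/andP; split.
    apply: le_lt_trans (u_past 0 _) _; first by move: tau0; lra.
    by move: delta0; lra.
  by apply: le_lt_trans W_past _; move: delta0; lra.
rewrite /f lt_min !subr_gt0; apply/andP/decay_step; first by rewrite t0.
- by move=> s /H; rewrite /f lt_min !subr_gt0 => /andP[].
- by move=> s /H; rewrite /f lt_min !subr_gt0 => /andP[].
Qed.

End SmallDelay.
End Decay.

(** * Asymptotic stability for short delays *)

Section AsymptoticStability.
Context {R : realType}.
Local Notation mu := (@lebesgue_measure R).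
Implicit Types (tau rho omega d s t T x y : R) (r v phi psi : R -> R).

Lemma history_dist_ge tau rho omega r v t : 0 <= tau ->
  {within `[t - tau, t], continuous r} ->
  (forall s, t - tau <= s <= t -> `|r s - rho| <= history_dist tau rho omega r v t) /\
  \int[mu]_(s in `[t - tau, t]) `|v s - omega| <= history_dist tau rho omega r v t.
Proof.
move=> tau0 cr; have tt : t - tau <= t by rewrite lerBlDr lerDl.
pose A := [set `|r s - rho| | s in `[t - tau, t]].
have [c _ cmax] : exists2 c, c \in `[t - tau, t] &
    forall s, s \in `[t - tau, t] -> `|r s - rho| <= `|r c - rho|.
  apply: (@EVT_max _ (fun s => `|r s - rho|)) => // x.
  by apply: cvg_norm; apply: cvgB; [exact: cr|exact: cvg_cst].
have hs : has_sup A.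
  split; first by exists `|r t - rho|, t => //=; rewrite in_itv/= tt lexx.
  by exists `|r c - rho| => _ [s /= sI <-]; exact: cmax.
have I0 : 0 <= \int[mu]_(s in `[t - tau, t]) `|v s - omega| by exact: Rintegral_ge0.
have le_supA s : t - tau <= s <= t -> `|r s - rho| <= sup A.
  by move=> sI; apply: ub_le_sup; [case: hs|exists s => //=; rewrite in_itv].
split.
  by move=> s /le_supA h; apply: (le_trans h); rewrite /history_dist -/A lerDl.
have : 0 <= sup A by apply: le_trans (le_supA t _); rewrite ?tt ?lexx.
by rewrite /history_dist -/A lerDr.
Qed.

Lemma history_dist_le tau rho omega r v t (B C : R) : 0 <= tau ->
  (forall s, t - tau <= s <= t -> `|r s - rho| <= B) ->
  \int[mu]_(s in `[t - tau, t]) `|v s - omega| <= C ->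
  history_dist tau rho omega r v t <= B + C.
Proof.
move=> tau0 rB vC; apply: lerD => //; apply: ge_sup.
  by exists `|r t - rho|, t => //=; rewrite in_itv/= lexx lerBlDr lerDl tau0.
by move=> _ [s sI <-]; apply: rB; move: sI; rewrite /= in_itv.
Qed.

Section SmallDelay.
Variables (tau rho omega : R).
Hypotheses (tau0 : 0 < tau) (tau_small : tau <= 100^-1) (rho0 : 0 < rho).
Hypothesis rho_cos : rho ^+ 2 * cos (omega * tau) = 1.
Hypothesis rho_sin : omega = 1 + rho ^+ 2 * sin (omega * tau).
Hypothesis k_small : `|omega - 1| <= 20^-1.

(** The size in the state space that bounds both the relative radius and the
    angular velocity by [d]. *)
Let scale (d : R) := d * Num.min 1 rho.

Let scale_gt0 d : 0 < d -> 0 < scale d.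
Proof. by move=> d0; rewrite mulr_gt0// lt_min ltr01. Qed.

Let history_small (d : R) r v : 0 < d -> {within `[- tau, 0], continuous r} ->
  history_dist tau rho omega r v 0 < scale d ->
  (forall s, - tau <= s <= 0 -> `|r s / rho - 1| <= d) /\
  \int[mu]_(s in `[0 - tau, 0]) `|v s - omega| <= d.
Proof.
move=> d0 cr hd.
have := @history_dist_ge tau rho omega r v 0 (ltW tau0).
rewrite sub0r => /(_ cr) [h1 h2].
have s1 : scale d <= d by rewrite /scale ler_piMr ?(ltW d0)// ge_min lexx.
have s2 : scale d <= d * rho by rewrite /scale ler_pM2l// ge_min lexx orbT.
split; last by apply: le_trans h2 _; apply: le_trans s1; exact: ltW.
move=> s /h1 hs; have -> : r s / rho - 1 = (r s - rho) / rho by field; rewrite gt_eqF.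
rewrite normrM normfV (gtr0_norm rho0) ler_pdivrMr//.
by apply: (le_trans hs); apply: le_trans s2; exact: ltW.
Qed.

Let scaled_dist (x y : R) : `|x / rho - 1| <= y -> `|x - rho| <= rho * y.
Proof.
move=> h; have -> : x - rho = rho * (x / rho - 1) by field; rewrite gt_eqF.
by rewrite normrM (gtr0_norm rho0) ler_pM2l.
Qed.

Let history_decay (d T : R) r v : 0 < d -> d <= 1000^-1 -> 0 < T ->
  coupled_solution tau T r v -> history_dist tau rho omega r v 0 < scale d ->
  forall t, 0 <= t <= T ->
    history_dist tau rho omega r v t <= (rho + 1) * (2 * d * expR (- 4^-1 * (t - tau))).
Proof.
move=> d0 d1 T0 sol hd t tT; have [cr _ _] := sol.
have [hu hW] : (forall s, - tau <= s <= 0 -> `|r s / rho - 1| <= d) /\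
    \int[mu]_(s in `[0 - tau, 0]) `|v s - omega| <= d.
  apply: history_small => //; apply: continuous_subspaceW cr.
  by apply: subset_itv; rewrite bnd_simp// ltW.
have dec := @exponential_decay R tau rho omega d T r v tau0 tau_small rho0
  rho_cos rho_sin k_small d0 d1 T0 sol hu hW.
have ymono s : t - tau <= s ->
    2 * d * expR (- 4^-1 * s) <= 2 * d * expR (- 4^-1 * (t - tau)).
  by move=> ts; apply: ler_wpM2l; [rewrite mulr_ge0// ltW|rewrite ler_expR; lra].
rewrite mulrDl mul1r; apply: history_dist_le; first exact: ltW.
  move=> s sI; apply: scaled_dist; apply: le_trans (ymono s (andP sI).1).
  have [s0|s0] := leP 0 s.
    by apply: ltW; apply: (dec s _).1; rewrite s0; lra.
  apply: (@le_trans _ _ d); first by apply: hu; lra.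
  have : 1 <= expR (- 4^-1 * s) by apply: le_trans (expR_ge1Dx _); lra.
  move=> h; have : d * 1 <= d * expR (- 4^-1 * s) by apply: ler_wpM2l => //; exact: ltW.
  by lra.
apply: ltW; apply: lt_le_trans (dec t tT).2 _; apply: ymono.
by move: tau0; lra.
Qed.

Let expR_delay t : 0 <= t -> expR (- 4^-1 * (t - tau)) <= 101 / 100.
Proof.
move=> t0.
have -> : - 4^-1 * (t - tau) = - (4^-1 * (t - tau)) by ring.
rewrite expRN; have h : 1 - 400^-1 <= expR (4^-1 * (t - tau)).
  by apply: le_trans (expR_ge1Dx _); move: tau_small; lra.
rewrite invf_ple ?posrE ?expR_gt0//; last by lra.
Qed.

Lemma small_delay_lyapunov_stable : lyapunov_stable tau rho omega.
Proof.
move=> eps eps0; have rho1 : 0 < rho + 1 by rewrite addr_gt0.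
pose d := Num.min 1000^-1 (eps / (rho + 1) / 3).
have d0 : 0 < d by rewrite lt_min; apply/andP; split; [lra|rewrite !divr_gt0].
have d1 : d <= 1000^-1 by rewrite ge_min lexx.
exists (scale d); first exact: scale_gt0.
move=> T r v T0 sol hd t tT.
apply: (le_lt_trans (history_decay d T r v d0 d1 T0 sol hd t tT)).
have [t0 _] := andP tT; have e1 := expR_delay t t0.
have : d <= eps / (rho + 1) / 3 by rewrite ge_min lexx orbT.
have e0 : 0 < eps / (rho + 1) by rewrite divr_gt0.
move=> h; rewrite -ltr_pdivlMl// [ltRHS]mulrC.
apply: (@le_lt_trans _ _ (2 * d * (101 / 100))); last by lra.
by rewrite ler_pM2l// mulr_gt0.
Qed.

(** Histories close to the equilibrium are continued by the truncated system, whose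
    clamp is out of reach of a decaying solution. *)
Lemma small_delay_locally_attractive : locally_attractive tau rho omega.
Proof.
have rho1 : 0 < rho + 1 by rewrite addr_gt0.
pose d : R := 1000^-1.
have d0 : 0 < d by rewrite /d; lra.
exists (scale d); first exact: scale_gt0.
split; last first.
  move=> r v sol hd; apply/cvgrPdist_le => e e0; near=> t.
  have t0 : 0 < t by near: t; exact: nbhs_pinfty_gt.
  have := history_decay d t r v d0 (lexx _) t0 (sol _ t0) hd t.
  rewrite (ltW t0) lexx => /(_ isT) h.
  have cr : {within `[t - tau, t], continuous r}.
    have [cr _ _] := sol t t0; apply: continuous_subspaceW cr.
    by apply: subset_itv; rewrite bnd_simp// -[leLHS]sub0r lerD2r ltW.
  have [_ hge] := @history_dist_ge tau rho omega r v t (ltW tau0) cr.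
  have I0 : 0 <= \int[mu]_(s in `[t - tau, t]) `|v s - omega| by exact: Rintegral_ge0.
  rewrite sub0r normrN (ger0_norm (le_trans I0 hge)); apply: (le_trans h).
  pose C := (rho + 1) * (2 * d).
  have C0 : 0 < C by rewrite mulr_gt0// mulr_gt0.
  have tbig : 4 * (C / e) + tau <= t by near: t; apply: nbhs_pinfty_ge; exact: num_real.
  have Ce : 0 < C / e by rewrite divr_gt0.
  have hE : C / e <= expR (4^-1 * (t - tau)) by apply: le_trans (expR_ge1Dx _); lra.
  have -> : - 4^-1 * (t - tau) = - (4^-1 * (t - tau)) by ring.
  set E := expR (4^-1 * (t - tau)) in hE *.
  have E0 : 0 < E by exact: expR_gt0.
  have -> : (rho + 1) * (2 * d * expR (- (4^-1 * (t - tau)))) = C / E.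
    by rewrite expRN -/E /C !mulrA.
  by rewrite ler_pdivrMr// mulrC -ler_pdivrMr.
move=> phi psi cphi ipsi hd.
have [hu hW] := history_small d phi psi d0 cphi hd.
have M0 : 0 < 2 * rho by rewrite mulr_gt0.
have [r [v [th [[cr _] past _ _ sol]]]] :=
  @truncated_coupled_solution R (2 * rho) tau phi psi M0 tau0 cphi ipsi.
have bnd x : `|x / rho - 1| <= 2 * d -> `|x| < 2 * rho.
  move/scaled_dist => h; have -> : x = (x - rho) + rho by rewrite subrK.
  apply: (le_lt_trans (ler_normD _ _)); rewrite (gtr0_norm rho0).
  by move: h rho0; rewrite /d; lra.
have r_past s : - tau <= s <= 0 -> `|r s / rho - 1| <= d.
  by move=> sI; have [-> _ _] := past s sI; exact: hu.
have v_past : \int[mu]_(s in `[0 - tau, 0]) `|v s - omega| <= d.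
  apply: le_trans hW; rewrite le_eqVlt; apply/orP; left; apply/eqP.
  apply: eq_Rintegral => s; rewrite inE/= in_itv/= sub0r => sI.
  by have [_ -> _] := past s sI.
(* Were the clamp reached at some first time [t], the truncated solution would
   solve the coupled system up to [t], and its decay would keep it away. *)
have never_truncated T : 0 < T -> forall t, 0 <= t <= T -> 0 < 2 * rho - `|r t|.
  move=> T0; apply: positive_by_continuity.
    apply: continuous_subspaceT => x; apply: cvgB; first exact: cvg_cst.
    by apply: cvg_norm; exact: cr.
  move=> t /andP[]; rewrite le_eqVlt => /predU1P[<- _ _|t0 tT H];
    rewrite subr_gt0; apply: (bnd).
    by apply: (@le_trans _ _ d); [apply: r_past; move: tau0; lra|rewrite /d; lra].
  have solt : coupled_solution tau t r v.
    apply: sol => // s /andP[ts st]; have [s0|s0] := leP 0 s.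
      by have := H s; rewrite s0 st subr_gt0 => /(_ isT) /ltW.
    apply/ltW/bnd; apply: (@le_trans _ _ d); last by rewrite /d; lra.
    by apply: r_past; rewrite ts ltW.
  have := @exponential_decay R tau rho omega d t r v tau0 tau_small rho0
    rho_cos rho_sin k_small d0 (lexx _) t0 solt r_past v_past t.
  rewrite (ltW t0) lexx => /(_ isT) [/ltW h _]; apply: (le_trans h).
  rewrite ler_piMr ?mulr_ge0 ?ltW// expR_lt1; move: t0; lra.
exists r, v; split; last by move=> s sI; have [-> -> _] := past s sI.
move=> T T0; apply: sol => // t /andP[tt tT]; have [t0|t0] := leP 0 t.
  by have := never_truncated T T0 t; rewrite t0 (ltW tT) subr_gt0 => /(_ isT) /ltW.
apply/ltW/bnd; apply: (@le_trans _ _ d); last by rewrite /d; lra.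
by apply: r_past; rewrite tt ltW.
Unshelve. all: by end_near. Qed.

Theorem small_delay_asymptotically_stable : asymptotically_stable tau rho omega.
Proof.
split; [exact: small_delay_lyapunov_stable|exact: small_delay_locally_attractive].
Qed.

End SmallDelay.
End AsymptoticStability.

(** * The expanding cone *)

Section Cone.
Context {R : realType}.
Implicit Types (a b d e k m s t T x y : R).

Section Linearization.
Variables (e k a b d : R).
Hypotheses (e_small : 1000 * e <= 1) (k_large : 400 <= k).
Hypotheses (a_small : `|a| <= e) (b_small : `|b| <= e) (d_small : `|d| <= e).

Let S := `|a| + `|b| + `|d|.

Let e0 : 0 <= e. Proof. exact: le_trans a_small. Qed.

Let eM x : e * `|x| <= `|x| / 1000.
Proof.
have : 1000 * e * `|x| <= 1 * `|x| by apply: ler_wpM2r.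
by rewrite mul1r; lra.
Qed.

Let ab_bnd : `|a * b| <= e * `|b|.
Proof. by rewrite normrM; apply: ler_wpM2r. Qed.

Let d2 : d ^+ 2 <= e * `|d|.
Proof. by rewrite -real_normK ?num_real// expr2; apply: ler_wpM2r. Qed.

Let C_bnd : `|1 - cos d| <= e * `|d|.
Proof.
rewrite ger0_norm ?onem_cos_ge0//; apply: (le_trans (onem_cos_le d)).
have : 0 <= d ^+ 2 by exact: sqr_ge0.
by move: d2; lra.
Qed.

Let S_bnd : `|sin d - d| <= e * `|d|.
Proof.
apply: (le_trans (ler_norm_sinB d _)) d2; apply: (le_trans d_small).
by move: e_small e0; lra.
Qed.

Let one_bnd x : `|x| <= e -> `|1 + x| <= 11 / 10.
Proof.
move=> x1; apply: (le_trans (ler_normD _ _)); rewrite normr1.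
by move: e_small e0 x1; lra.
Qed.

Let h_bnd : `|(1 + a) * (1 + b)| <= 11 / 10 * (11 / 10).
Proof. by apply: ler_normM; exact: one_bnd. Qed.

Let k0 : 0 <= k. Proof. by move: k_large; lra. Qed.

Let S_split : [/\ 0 <= `|a|, 0 <= `|b| & 0 <= `|d|] /\
  [/\ k * `|d| <= k * S, k * `|b| <= k * S & 400 * S <= k * S].
Proof.
have [a0 b0 dd0] : [/\ 0 <= `|a|, 0 <= `|b| & 0 <= `|d|] by [].
split; first by split.
split.
- by apply: ler_wpM2l; [exact: k0|rewrite /S; lra].
- by apply: ler_wpM2l; [exact: k0|rewrite /S; lra].
- by apply: ler_wpM2r; [rewrite /S; lra|exact: k_large].
Qed.

(** For [k >= 400] the linear terms without a factor [k], such as [- (a + b)] here,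
    are as negligible on the scale [k S] as the quadratic ones. *)
Lemma radial_field_cone : `|radial_field k a b d - k * d| <= k / 100 * S.
Proof.
have -> : radial_field k a b d - k * d = - (a + b) + - (a * b)
   + - (a * (a + b + a * b)) + (1 + a) * ((1 + a) * (1 + b)) * (1 - cos d)
   + k * ((a + a + b + a * a + (a * b + a * b) + a * (a * b)) * sin d + (sin d - d)).
  by rewrite /radial_field; ring.
have ee : e * e <= e / 1000.
  have : 1000 * e * e <= 1 * e by apply: ler_wpM2r; [exact: e0|exact: e_small].
  by rewrite mul1r; lra.
have abe : `|a * b| <= e.
  by apply: (le_trans (ler_normM _ _ _ _ a_small b_small)); move: ee e0; lra.
have aa : `|a * a| <= e / 1000 by apply: le_trans ee; apply: ler_normM.
have ab' : `|a * b| <= e / 1000 by apply: le_trans ee; apply: ler_normM.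
have aab : `|a * (a * b)| <= e / 1000 by apply: le_trans ee; apply: ler_normM.
have c_bnd : `|a + a + b + a * a + (a * b + a * b) + a * (a * b)| <= 4 * e.
  apply: (@le_trans _ _ (e + e + e + e / 1000 + (e / 1000 + e / 1000) + e / 1000));
    last by move: e0; lra.
  apply: ler_normD2; last exact: aab.
  apply: ler_normD2; last exact: (ler_normD2 _ _ _ _ ab' ab').
  apply: ler_normD2; last exact: aa.
  by apply: ler_normD2; last exact: b_small; exact: ler_normD2.
have sum_bnd : `|a * (a + b + a * b)| <= (`|a| + `|b| + `|b|) / 1000.
  apply: (@le_trans _ _ (e * (`|a| + `|b| + `|b| / 1000))).
    apply: ler_normM; first exact: a_small.
    by apply: ler_normD2; [exact: ler_normD|exact: le_trans ab_bnd (eM b)].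
  have h : 0 <= `|a| + `|b| + `|b| / 1000.
    by have := normr_ge0 a; have := normr_ge0 b; lra.
  have : 1000 * e * (`|a| + `|b| + `|b| / 1000) <= 1 * (`|a| + `|b| + `|b| / 1000).
    by apply: ler_wpM2r; [exact: h|exact: e_small].
  by have := normr_ge0 b; lra.
apply: (@le_trans _ _ (`|a| + `|b| + `|b| / 1000 + (`|a| + `|b| + `|b|) / 1000
   + 11 / 10 * (11 / 10 * (11 / 10)) * (`|d| / 1000)
   + k * (4 * (`|d| / 1000) + `|d| / 1000))).
  apply: ler_normD2; last first.
    apply: ler_normM; first by rewrite (ger0_norm k0).
    apply: ler_normD2; last exact: le_trans S_bnd (eM d).
    apply: (@le_trans _ _ (4 * e * `|d|)).
      by apply: ler_normM; [exact: c_bnd|exact: ler_norm_sin].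
    by have := eM d; lra.
  apply: ler_normD2; last first.
    apply: ler_normM; last exact: le_trans C_bnd (eM d).
    by apply: ler_normM; [exact: one_bnd|exact: h_bnd].
  apply: ler_normD2; last by rewrite normrN; exact: sum_bnd.
  apply: ler_normD2; last by rewrite normrN; exact: le_trans ab_bnd (eM b).
  by rewrite normrN; exact: ler_normD.
have [[a0 b0 dd0] [kd kb kS]] := S_split.
by move: kd kS; rewrite /S; lra.
Qed.

Lemma angular_field_cone : `|angular_field k a b d - k * (a + b)| <= k / 100 * S.
Proof.
have -> : angular_field k a b d - k * (a + b) =
   k * (a * b - (1 + a) * (1 + b) * (1 - cos d)) + (1 + a) * (1 + b) * sin d.
  by rewrite /angular_field; ring.
apply: (@le_trans _ _ (k * (`|b| / 1000 + 11 / 10 * (11 / 10) * (`|d| / 1000))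
   + 11 / 10 * (11 / 10) * `|d|)).
  apply: ler_normD2; last by apply: ler_normM; [exact: h_bnd|exact: ler_norm_sin].
  apply: ler_normM; first by rewrite (ger0_norm k0).
  apply: ler_normD2; first exact: le_trans ab_bnd (eM b).
  by rewrite normrN; apply: ler_normM; [exact: h_bnd|exact: le_trans C_bnd (eM d)].
have [[a0 b0 dd0] [kd kb kS]] := S_split.
by move: kd kb kS; rewrite /S; lra.
Qed.

End Linearization.

(** The cone condition [`|q| <= p] makes both coordinates nonnegative, so that
    their sum [p] dominates all the error terms. *)
Lemma cone_fields e k a b (th tht : R) : 1000 * e <= 1 -> 400 <= k ->
  `|a| <= e -> `|b| <= e -> `|th - tht| <= e ->
  `|a - th| <= a + th -> `|b - tht| <= b + tht -> b + tht <= a + th ->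
  let F := radial_field k a b (th - tht) in let G := angular_field k a b (th - tht) in
  `|F + G - k * ((a + th) + (b - tht))| <= 4 / 100 * k * (a + th) /\
  `|F - G + k * ((a - th) + (b + tht))| <= 4 / 100 * k * (a + th).
Proof.
move=> e1 k1 a1 b1 d1 qa qb pp F G.
have [a0 th0] : 0 <= a /\ 0 <= th.
  by move: qa; rewrite ler_norml => /andP[? ?]; split; lra.
have [b0 tht0] : 0 <= b /\ 0 <= tht.
  by move: qb; rewrite ler_norml => /andP[? ?]; split; lra.
have k0 : 0 <= k by move: k1; lra.
have hF := radial_field_cone e k a b (th - tht) e1 k1 a1 b1 d1.
have hG := angular_field_cone e k a b (th - tht) e1 k1 a1 b1 d1.
have hS : k / 100 * (`|a| + `|b| + `|th - tht|) <= k / 100 * (2 * (a + th)).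
  apply: ler_wpM2l; first by lra.
  rewrite (ger0_norm a0) (ger0_norm b0).
  have : `|th - tht| <= th + tht.
    by apply: (le_trans (ler_normB _ _)); rewrite !ger0_norm.
  by lra.
have hF' := le_trans hF hS; have hG' := le_trans hG hS; split.
  have -> : F + G - k * ((a + th) + (b - tht)) =
     (F - k * (th - tht)) + (G - k * (a + b)) by ring.
  by apply: (le_trans (ler_normD2 _ _ _ _ hF' hG')); lra.
have -> : F - G + k * ((a - th) + (b + tht)) =
     (F - k * (th - tht)) - (G - k * (a + b)) by ring.
by apply: (le_trans (ler_normB _ _)); apply: (le_trans (lerD hF' hG')); lra.
Qed.

End Cone.

Section ConeEscape.
Context {R : realType}.
Implicit Types (s t T x y sg : R).
Variables (e k tau eta : R) (u th : R -> R).
Hypotheses (e_small : 1000 * e <= 1) (k_large : 400 <= k).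
Hypotheses (tau0 : 0 < tau) (ktau : 9 / 10 <= k * tau) (eta0 : 0 < eta).
Hypotheses (u_cont : continuous u) (th_cont : continuous th).

Let nu := 2 / 3 * k.

Hypothesis past : forall s, - tau <= s <= 0 ->
  u s = eta * expR (2 / 3 * k * s) /\ th s = eta * expR (2 / 3 * k * s).
Hypothesis u_derive : forall t, 0 < t ->
  is_derive t 1 u (radial_field k (u t) (u (t - tau)) (th t - th (t - tau))).
Hypothesis th_derive : forall t, 0 < t ->
  is_derive t 1 th (angular_field k (u t) (u (t - tau)) (th t - th (t - tau))).
Hypothesis u_small : forall t, - tau <= t -> `|u t| <= e.
Hypothesis D_small : forall t, 0 <= t -> `|th t - th (t - tau)| <= e.

Let p t := u t + th t.
Let q t := u t - th t.
Let F t := radial_field k (u t) (u (t - tau)) (th t - th (t - tau)).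
Let G t := angular_field k (u t) (u (t - tau)) (th t - th (t - tau)).

Let k0 : 0 < k. Proof. by move: k_large; lra. Qed.

Let p_cont : continuous p.
Proof. by move=> t; apply: cvgD; [exact: u_cont|exact: th_cont]. Qed.

Let q_cont : continuous q.
Proof. by move=> t; apply: cvgB; [exact: u_cont|exact: th_cont]. Qed.

Let delay_cont (g : R -> R) : continuous g -> continuous (fun t => g (t - tau)).
Proof.
move=> cg t; apply: (@continuous_comp _ _ _ (fun s => s - tau) g); last exact: cg.
by apply: cvgB; [exact: cvg_id|exact: cvg_cst].
Qed.

Let D_cont : continuous (fun t => th t - th (t - tau)).
Proof. by move=> t; apply: cvgB; [exact: th_cont|exact: delay_cont]. Qed.

Let cosD_cont : continuous (fun t => cos (th t - th (t - tau))).
Proof.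
move=> t; apply: (@continuous_comp _ _ _ (fun s => th s - th (s - tau)) cos).
  exact: D_cont.
exact: continuous_cos.
Qed.

Let sinD_cont : continuous (fun t => sin (th t - th (t - tau))).
Proof.
move=> t; apply: (@continuous_comp _ _ _ (fun s => th s - th (s - tau)) sin).
  exact: D_cont.
exact: continuous_sin.
Qed.

Let one_cont (g : R -> R) : continuous g -> continuous (fun t => 1 + g t).
Proof. by move=> cg t; apply: cvgD; [exact: cvg_cst|exact: cg]. Qed.

Let h_cont : continuous (fun t => (1 + u t) * (1 + u (t - tau))).
Proof.
move=> t; apply: cvgM; first exact: one_cont.
by apply: (one_cont (fun s => u (s - tau))); exact: delay_cont.
Qed.

Let F_cont : continuous F.
Proof.
move=> t; apply: cvgM; first exact: one_cont.
apply: cvgB; first exact: cvg_cst.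
apply: cvgM; first exact: h_cont.
apply: cvgB; first exact: cosD_cont.
by apply: cvgM; [exact: cvg_cst|exact: sinD_cont].
Qed.

Let G_cont : continuous G.
Proof.
move=> t; apply: cvgD; first exact: cvg_cst.
apply: cvgM; first exact: h_cont.
apply: cvgD; last exact: sinD_cont.
by apply: cvgM; [exact: cvg_cst|exact: cosD_cont].
Qed.

Let p_derive t : 0 < t -> is_derive t 1 p (F t + G t).
Proof. by move=> t0; apply: is_deriveD; [exact: u_derive|exact: th_derive]. Qed.

Let q_derive t : 0 < t -> is_derive t 1 q (F t - G t).
Proof. by move=> t0; apply: is_deriveB; [exact: u_derive|exact: th_derive]. Qed.

Let p_past s : - tau <= s <= 0 -> p s = 2 * eta * expR (nu * s).
Proof. by move=> /past[us ths]; rewrite /p us ths /nu; ring. Qed.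

Let q_past s : - tau <= s <= 0 -> q s = 0.
Proof. by move=> /past[us ths]; rewrite /q us ths subrr. Qed.

Let P t := expR (- nu * t) * p t.

Let P_past s : - tau <= s <= 0 -> P s = 2 * eta.
Proof.
by move=> h; rewrite /P p_past// mulrCA -expRD mulNr addNr expR0 mulr1.
Qed.

Section Growing.
Variable t : R.
Hypothesis t0 : 0 <= t.
Hypothesis growth : forall s, 0 < s < t -> nu * p s <= F s + G s.

Let P_mono x y : 0 <= x -> x <= y -> y <= t -> P x <= P y.
Proof.
move=> x0 xy yt.
apply: (@nondecreasing_of_is_derive _ P
  (fun s => expR (- nu * s) * (F s + G s) + p s * (- nu * expR (- nu * s))) x y xy).
- move=> s xsy; have s0 : 0 < s by lra.
  exact: (@is_deriveM _ _ _ _ _ _ _ _ (is_derive_expRM _ _) (p_derive s s0)).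
- move=> s xsy; have st : 0 < s < t by lra.
  have -> : expR (- nu * s) * (F s + G s) + p s * (- nu * expR (- nu * s)) =
     expR (- nu * s) * (F s + G s - nu * p s) by ring.
  by rewrite mulr_ge0 ?expR_ge0// subr_ge0; exact: growth.
- apply: continuous_subspaceT => s.
  by apply: cvgM; [exact: continuous_expRM|exact: p_cont].
Qed.

Let P0 : P 0 = 2 * eta. Proof. by apply: P_past; move: tau0; lra. Qed.

Lemma growing_P_ge s : - tau <= s -> s <= t -> 2 * eta <= P s.
Proof.
move=> ts st; have [s0|s0] := leP s 0; first by rewrite P_past// ts.
by rewrite -P0; apply: P_mono => //; exact: ltW.
Qed.

Lemma growing_p_gt0 s : - tau <= s -> s <= t -> 0 < p s.
Proof.
move=> ts st; have h := growing_P_ge s ts st.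
have : 0 < P s by apply: lt_le_trans h; rewrite mulr_gt0.
by rewrite /P pmulr_rgt0// expR_gt0.
Qed.

(** Growth at the rate [nu] makes the delayed value of [p] smaller than the present
    one by the factor [exp (nu tau) >= 1 + nu tau >= 8/5]. *)
Lemma growing_delay s : 0 <= s -> s <= t -> 8 / 5 * p (s - tau) <= p s.
Proof.
move=> s0 st; have h : P (s - tau) <= P s.
  have [st0|st0] := leP (s - tau) 0.
    rewrite (P_past (s - tau)); last by rewrite st0 andbT; lra.
    by apply: growing_P_ge => //; move: tau0; lra.
  by apply: P_mono => //; [exact: ltW|move: tau0; lra].
have : expR (nu * tau) * p (s - tau) <= p s.
  move: h; rewrite /P [- nu * (s - tau)](_ : _ = - nu * s + nu * tau); last by ring.
  by rewrite expRD -mulrA ler_pM2l// expR_gt0.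
apply: le_trans; apply: ler_wpM2r.
  by apply: ltW; apply: growing_p_gt0; move: tau0; lra.
apply: le_trans (expR_ge1Dx _); rewrite /nu -mulrA; move: ktau; lra.
Qed.

End Growing.

(** Any opening [c] works for which [p' >= nu p] and the inward motion of [q] on
    the boundary both survive the errors: [1 - 5/8 c - 4/100 > 2/3] and
    [5/3 c > 5/8 + 4/100]. *)
Let c : R := 43 / 100.

Let f t := Num.min (F t + G t - nu * p t) (Num.min (c * p t - q t) (c * p t + q t)).

Let f_gt0 t : (0 < f t) =
  [&& nu * p t < F t + G t, q t < c * p t & - (c * p t) < q t].
Proof. by rewrite /f !lt_min -(subr_gt0 (- (c * p t))) opprK !subr_gt0 [q t + _]addrC. Qed.

(** One step of the continuous induction: growth and the cone condition before
    time [t] give both of them, strictly, at time [t]. *)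
Let cone_step t : 0 <= t -> (forall s, 0 <= s < t -> 0 < f s) -> 0 < f t.
Proof.
move=> t0 H.
have growth s : 0 < s < t -> nu * p s <= F s + G s.
  move=> st; have := H s; rewrite f_gt0 => h.
  by have /h /and3P[/ltW] : 0 <= s < t by lra.
have cone_past s : - tau <= s -> s < t -> `|q s| <= c * p s.
  move=> ts st; have [s0|s0] := leP 0 s.
    have := H s; rewrite s0 st f_gt0 => /(_ isT) /and3P[_ q1 q2].
    by rewrite ler_norml !ltW.
  rewrite q_past ?normr0; last by rewrite ts ltW.
  apply: mulr_ge0; first by rewrite /c; lra.
  by apply: ltW; apply: (growing_p_gt0 t growth) => //; exact: ltW.
have cone_t sg : sg = 1 \/ sg = -1 -> sg * q t < c * p t.
  move=> sgE.
  (* Since [q' = - k q] up to delayed terms, the weight [exp (k s)] cancels [q] from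
     the derivative of [Psi]. *)
  pose Psi s := expR (k * s) * (c * p s - sg * q s).
  have mono : Psi 0 <= Psi t.
    apply: (@nondecreasing_of_is_derive _ Psi (fun s =>
      expR (k * s) * (c * (F s + G s) - sg * (F s - G s)) +
      (c * p s - sg * q s) * (k * expR (k * s))) 0 t t0).
    - move=> s st; have s0 : 0 < s by lra.
      apply: (@is_deriveM _ _ _ _ _ _ _ _ (is_derive_expRM _ _)).
      apply: is_deriveB.
        exact: (@is_deriveZ _ _ _ p c s 1 _ (p_derive s s0)).
      exact: (@is_deriveZ _ _ _ q sg s 1 _ (q_derive s s0)).
    - move=> s st; have [s0 st'] := andP st.
      have -> : expR (k * s) * (c * (F s + G s) - sg * (F s - G s)) +
        (c * p s - sg * q s) * (k * expR (k * s)) =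
        expR (k * s) *
          (c * (F s + G s) + k * (c * p s) - sg * (F s - G s + k * q s)) by ring.
      rewrite mulr_ge0 ?expR_ge0//.
      have qs : `|q s| <= c * p s by apply: cone_past => //; move: tau0; lra.
      have qst : `|q (s - tau)| <= c * p (s - tau) by apply: cone_past; move: tau0; lra.
      have ps : 0 < p s by apply: (growing_p_gt0 t growth); move: tau0; lra.
      have pst : 0 < p (s - tau) by apply: (growing_p_gt0 t growth); move: tau0; lra.
      have dl := growing_delay t growth s (ltW s0) (ltW st').
      have := cone_fields e k (u s) (u (s - tau)) (th s) (th (s - tau)) e_small k_large.
      rewrite -/(p s) -/(q s) -/(p (s - tau)) -/(q (s - tau)) -/(F s) -/(G s).
      case.
      + by apply: u_small; move: tau0; lra.
      + by apply: u_small; move: tau0; lra.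
      + by apply: D_small; exact: ltW.
      + by apply: (le_trans qs); rewrite /c; lra.
      + by apply: (le_trans qst); rewrite /c; lra.
      + by lra.
      move=> _; set X := F s - G s; rewrite mulrDr addrA ler_norml => /andP[X1 X2].
      have gr := growth s st.
      have kp : 0 <= k * p s by rewrite mulr_ge0// ltW.
      have kpt : k * p (s - tau) <= 5 / 8 * (k * p s).
        have : k * (8 / 5 * p (s - tau)) <= k * p s by rewrite ler_pM2l.
        by lra.
      have kpt0 : 0 <= k * p (s - tau) by rewrite mulr_ge0// ltW.
      move: gr; rewrite /nu /c; case: sgE => ->; lra.
    - apply: continuous_subspaceT => s; apply: cvgM; first exact: continuous_expRM.
      by apply: cvgB; (apply: cvgM; first exact: cvg_cst); [exact: p_cont|exact: q_cont].
  have Psi0 : 0 < Psi 0.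
    have z0 : - tau <= (0 : R) <= 0 by move: tau0; lra.
    rewrite /Psi q_past// p_past// !mulr0 expR0 !mulr1 mul1r subr0 /c.
    by move: eta0; lra.
  have := lt_le_trans Psi0 mono; rewrite /Psi pmulr_rgt0 ?expR_gt0//.
  by rewrite subr_gt0.
have q1 : q t < c * p t by have := cone_t 1 (or_introl erefl); rewrite mul1r.
have q2 : - (c * p t) < q t.
  by have := cone_t (-1) (or_intror erefl); rewrite mulN1r ltrNl.
rewrite f_gt0 q1 q2 !andbT.
have qt : `|q t| <= c * p t by rewrite ler_norml !ltW.
have qtt : `|q (t - tau)| <= c * p (t - tau) by apply: cone_past; move: tau0; lra.
have pt : 0 < p t by apply: (growing_p_gt0 t growth); move: tau0; lra.
have ptt : 0 < p (t - tau) by apply: (growing_p_gt0 t growth); move: tau0; lra.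
have dl := growing_delay t growth t t0 (lexx _).
have := cone_fields e k (u t) (u (t - tau)) (th t) (th (t - tau)) e_small k_large.
rewrite -/(p t) -/(q t) -/(p (t - tau)) -/(q (t - tau)) -/(F t) -/(G t).
case.
- by apply: u_small; move: tau0; lra.
- by apply: u_small; move: tau0; lra.
- exact: D_small.
- by apply: (le_trans qt); rewrite /c; lra.
- by apply: (le_trans qtt); rewrite /c; lra.
- by lra.
set X := F t + G t; move=> + _; rewrite mulrDr ler_norml => /andP[X1 X2].
have kp : 0 < k * p t by rewrite mulr_gt0.
have kpt : k * p (t - tau) <= 5 / 8 * (k * p t).
  have : k * (8 / 5 * p (t - tau)) <= k * p t by rewrite ler_pM2l.
  by lra.
have kq : - (c * (k * p (t - tau))) <= k * q (t - tau).
  move: qtt; rewrite ler_norml => /andP[h _].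
  have : k * (- (c * p (t - tau))) <= k * q (t - tau) by rewrite ler_pM2l.
  by lra.
by move: kq; rewrite /nu /c; lra.
Qed.

(** The history lies on the axis [q = 0] of the cone and grows exactly at the rate
    [nu]; the solution then keeps growing at that rate, so [u] cannot stay
    bounded. *)
Theorem cone_escape : False.
Proof.
have f_pos t : 0 <= t -> 0 < f t.
  move=> t0; apply: (@positive_by_continuity _ f 0 t); last by rewrite t0 lexx.
    apply: continuous_subspaceT => s.
    apply: (@continuous_min _ R (fun t => F t + G t - nu * p t)
      (fun t => Num.min (c * p t - q t) (c * p t + q t))).
      apply: cvgB; first by apply: cvgD; [exact: F_cont|exact: G_cont].
      by apply: cvgM; [exact: cvg_cst|exact: p_cont].
    apply: (@continuous_min _ R (fun t => c * p t - q t) (fun t => c * p t + q t)).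
      by apply: cvgB; [apply: cvgM; [exact: cvg_cst|exact: p_cont]|exact: q_cont].
    by apply: cvgD; [apply: cvgM; [exact: cvg_cst|exact: p_cont]|exact: q_cont].
  by move=> s /andP[s0 _]; exact: cone_step.
have e0 : 0 <= e by apply: le_trans (u_small 0 _) => //; move: tau0; lra.
have nu0 : 0 < nu by rewrite /nu; move: k0; lra.
have [t [t0 eta_nut]] : exists t, 0 <= t /\ eta * (nu * t) = 2 * e.
  exists (2 * e / (eta * nu)); split; last by field; rewrite !gt_eqF.
  by apply: divr_ge0; [exact: mulr_ge0|apply: mulr_ge0; exact: ltW].
have growth s : 0 < s < t -> nu * p s <= F s + G s.
  by move=> /andP[/ltW /f_pos + _]; rewrite f_gt0 => /and3P[/ltW].
have Pt : 2 * eta <= P t.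
  apply: (growing_P_ge t growth t) => //.
  by apply: le_trans t0; rewrite oppr_le0 ltW.
have pt : 2 * eta * (1 + nu * t) <= p t.
  apply: (@le_trans _ _ (2 * eta * expR (nu * t))).
    by apply: ler_wpM2l; [rewrite mulr_ge0// ltW|exact: expR_ge1Dx].
  have -> : p t = P t * expR (nu * t).
    by rewrite /P mulrAC -expRD mulNr addNr expR0 mul1r.
  by apply: ler_wpM2r => //; exact: expR_ge0.
have := f_pos t t0; rewrite f_gt0 => /and3P[_ _ qt].
have ut : u t = (p t + q t) / 2 by rewrite /p /q; field.
have := u_small t; rewrite ler_norml ut => h.
have /h /andP[_] : - tau <= t by move: tau0; lra.
have eta_e : 2 * eta * (1 + nu * t) = 2 * eta + 4 * e.
  rewrite [LHS](_ : _ = 2 * eta + 2 * (eta * (nu * t))); last by ring.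
  by rewrite eta_nut; ring.
by move: qt pt eta0; rewrite eta_e /c; lra.
Qed.

End ConeEscape.

(** * Instability of fast rotations *)

Section Instability.
Context {R : realType}.
Local Notation mu := (@lebesgue_measure R).
Implicit Types (a b d e k s t T x y sg eta nu delta : R).

(** Reversing the orientation of the plane changes the sign of [k], so only
    positive [k] has to be treated. *)
Lemma radial_field_sym sg k a b d : sg = 1 \/ sg = -1 ->
  radial_field (sg * k) a b (sg * d) = radial_field k a b d.
Proof.
by case=> ->; rewrite /radial_field ?mul1r// !mulN1r sinN cosN mulrNN.
Qed.

Lemma angular_field_sym sg k a b d : sg = 1 \/ sg = -1 ->
  angular_field (sg * k) a b (sg * d) = sg * angular_field k a b d.
Proof.
by case=> ->; rewrite /angular_field ?mul1r// !mulN1r sinN cosN; ring.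
Qed.

(** If the equilibrium were stable, a small history on the axis of the expanding
    cone would give a truncated solution that stays small, hence a global solution
    of the coupled system, which [cone_escape] excludes. *)
Theorem fast_rotation_unstable (tau rho omega : R) : 0 < tau -> 0 < rho ->
  rho ^+ 2 * cos (omega * tau) = 1 -> omega = 1 + rho ^+ 2 * sin (omega * tau) ->
  400 <= `|omega - 1| -> 9 / 10 <= `|omega - 1| * tau ->
  unstable tau rho omega.
Proof.
move=> tau0 rho0 rho_cos rho_sin k_large ktau stable.
set k := omega - 1 in k_large ktau.
have Nt0 : - tau <= 0 by rewrite oppr_le0 ltW.
have rhoN0 : rho != 0 by rewrite gt_eqF.
have [sg [sgE sgk]] : exists sg, (sg = 1 \/ sg = -1) /\ sg * k = `|k|.
  have [k0|k0] := leP 0 k; first by exists 1; split; [left|rewrite mul1r ger0_norm].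
  by exists (-1); split; [right|rewrite mulN1r ltr0_norm].
have sgsg : sg * sg = 1 by case: sgE => ->; rewrite ?mulrNN mulr1.
have normsg x : `|sg * x| = `|x| by case: sgE => ->; rewrite ?mulN1r ?normrN ?mul1r.
have [e [e0 e1]] : exists e, 0 < e /\ 1000 * e <= 1 by exists (1000^-1); lra.
pose eps := e * Num.min 1 rho.
have eps0 : 0 < eps by rewrite mulr_gt0// lt_min ltr01.
have eps1 : eps <= e by rewrite /eps ler_piMr ?(ltW e0)// ge_min lexx.
have eps2 : eps <= rho * e by rewrite /eps mulrC ler_pM2r// ge_min lexx orbT.
have [delta delta0 st] := stable eps eps0.
pose nu := 2 / 3 * `|k|.
have nu0 : 0 < nu by rewrite /nu; move: k_large; lra.
have C0 : 0 < rho + nu * tau by rewrite addr_gt0// mulr_gt0.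
have [eta [eta0 eta1 eta_delta]] : exists eta,
    [/\ 0 < eta, eta <= 2^-1 & eta * (rho + nu * tau) < delta].
  exists (Num.min 2^-1 (delta / 2 / (rho + nu * tau))).
  have h : 0 < delta / 2 / (rho + nu * tau) by rewrite !divr_gt0.
  split; [by rewrite lt_min h andbT; lra|by rewrite ge_min lexx|].
  apply: (@le_lt_trans _ _ (delta / 2)); last by lra.
  by rewrite -ler_pdivlMr// ge_min lexx orbT.
pose phi s := rho * (1 + eta * expR (nu * s)).
pose psi s := omega + sg * (eta * (nu * expR (nu * s))).
have exp_cont := @continuous_expRM R nu.
have phi_cont : continuous phi.
  move=> s; apply: cvgM; first exact: cvg_cst.
  apply: cvgD; first exact: cvg_cst.
  by apply: cvgM; [exact: cvg_cst|exact: exp_cont].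
have psi_cont : continuous psi.
  move=> s; apply: cvgD; first exact: cvg_cst.
  do 3 (apply: cvgM; first exact: cvg_cst).
  exact: exp_cont.
have M0 : 0 < 2 * rho by rewrite mulr_gt0.
have [r [v [th [[cr cth] past thd phase sol_of_bnd]]]] :=
  @truncated_coupled_solution R (2 * rho) tau phi psi M0 tau0
    (continuous_subspaceT phi_cont) (@continuous_integrable_itv R psi _ _ psi_cont).
have exp_le1 s : s <= 0 -> expR (nu * s) <= 1.
  by move=> s0; rewrite -expR0 ler_expR mulr_ge0_le0// ltW.
have u_past s : - tau <= s <= 0 -> r s / rho - 1 = eta * expR (nu * s).
  by move=> /past[-> _ _]; rewrite /phi; field.
have dev_past s : - tau <= s <= 0 -> `|r s - rho| <= rho * eta.
  move=> sI; have -> : r s - rho = rho * (r s / rho - 1) by field.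
  rewrite u_past// ger0_norm; last by rewrite !mulr_ge0 ?expR_ge0 ?ltW.
  by rewrite ler_pM2l// ler_piMr ?(ltW eta0)// exp_le1// (andP sI).2.
have hd0 : history_dist tau rho omega r v 0 < delta.
  apply: le_lt_trans eta_delta.
  rewrite mulrDr mulrC; apply: history_dist_le; first exact: ltW.
    by move=> s; rewrite sub0r; exact: dev_past.
  rewrite (@eq_Rintegral _ _ _ mu _ (fun s => eta * (nu * expR (nu * s)))); last first.
    move=> s; rewrite inE/= in_itv/= sub0r => /past[_ -> _].
    rewrite /psi addrC addKr normsg ger0_norm//.
    apply: mulr_ge0; first exact: ltW.
    by apply: mulr_ge0; [exact: ltW|exact: expR_ge0].
  have -> : eta * (nu * tau) = eta * nu * (0 - (0 - tau)) by ring.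
  apply: le_Rintegral_itv; first by rewrite sub0r.
    apply: continuous_integrable_itv => s.
    do 2 (apply: cvgM; first exact: cvg_cst).
    exact: exp_cont.
  move=> s /andP[_ s0]; rewrite mulrA ler_piMr ?mulr_ge0 ?(ltW eta0) ?(ltW nu0)//.
  by apply: exp_le1; exact: ltW.
have near_eq T t : 0 < T -> coupled_solution tau T r v -> 0 <= t <= T ->
    (forall s, t - tau <= s <= t -> `|r s - rho| < eps) /\
    \int[mu]_(s in `[t - tau, t]) `|v s - omega| < eps.
  move=> T0 sol tT; have hd := st T r v T0 sol hd0 t tT.
  have [h1 h2] := @history_dist_ge R tau rho omega r v t (ltW tau0)
    (continuous_subspaceT cr).
  by split; [move=> s /h1 h; exact: le_lt_trans hd|exact: le_lt_trans hd].
have bnd x : `|x - rho| < rho -> `|x| < 2 * rho.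
  move=> h; have -> : x = (x - rho) + rho by rewrite subrK.
  apply: (le_lt_trans (ler_normD _ _)); rewrite (gtr0_norm rho0).
  by move: h; lra.
have bnd_past s : - tau <= s <= 0 -> `|r s| < 2 * rho.
  move=> /dev_past h; apply: bnd; apply: (le_lt_trans h).
  by apply: (@le_lt_trans _ _ (rho * 2^-1)); [rewrite ler_pM2l|move: rho0; lra].
(* Up to the first time at which the clamp is reached the solution is genuine, so
   that the assumed stability keeps it near the equilibrium. *)
have never_truncated T : 0 <= T -> `|r T| < 2 * rho.
  move=> T0; rewrite -subr_gt0.
  apply: (@positive_by_continuity _ (fun t => 2 * rho - `|r t|) 0 T);
    last by rewrite T0 lexx.
    apply: continuous_subspaceT => x; apply: cvgB; first exact: cvg_cst.
    by apply: cvg_norm; exact: cr.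
  move=> t /andP[]; rewrite le_eqVlt => /predU1P[<- _ _|t0 tT H]; rewrite subr_gt0.
    by apply: bnd_past; rewrite Nt0 lexx.
  have solt : coupled_solution tau t r v.
    apply: sol_of_bnd => // s /andP[ts st']; have [s0|s0] := leP 0 s.
      by have := H s; rewrite s0 st' subr_gt0 => /(_ isT) /ltW.
    by apply/ltW/bnd_past; rewrite ts ltW.
  have [h _] : (forall s, t - tau <= s <= t -> `|r s - rho| < eps) /\
      \int[mu]_(s in `[t - tau, t]) `|v s - omega| < eps.
    by apply: (near_eq t) => //; rewrite (ltW t0) lexx.
  apply: bnd; apply: (@lt_le_trans _ _ eps).
    by apply: h; rewrite lexx andbT lerBlDr lerDl ltW.
  apply: (le_trans eps2); rewrite ler_piMr ?(ltW rho0)//.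
  by move: e0 e1; lra.
have sol T : 0 < T -> coupled_solution tau T r v.
  move=> T0; apply: sol_of_bnd => // t /andP[tt tT]; apply: ltW.
  have [t0|t0] := leP 0 t; first exact: never_truncated.
  by apply: bnd_past; rewrite tt ltW.
pose u s := r s / rho - 1.
(* The angular deviation, normalized to continue the exponential history. *)
pose Th s := sg * (th s - omega * (s + tau) + sg * (eta * expR (nu * - tau))).
have v_int t : 0 <= t -> mu.-integrable `[t - tau, t] (EFin \o v).
  move=> t0; have [_ iv _] := sol (t + 1) (ltr_wpDl t0 ltr01).
  by apply: integrable_itv_sub iv; [rewrite lerBrDr addNr|rewrite lerDl ler01].
have DE t : 0 <= t -> \int[mu]_(s in `[t - tau, t]) (v s - omega) =
    th t - th (t - tau) - omega * tau.
  move=> t0; have tt : t - tau <= t by rewrite lerBlDr lerDl ltW.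
  have ivt := v_int t t0.
  rewrite RintegralB//; last first.
    by apply: continuous_integrable_itv => x; exact: cvg_cst.
  rewrite phase// Rintegral_itv_cst//.
  by congr (_ - omega * _); ring.
have ThD t : Th t - Th (t - tau) = sg * (th t - th (t - tau) - omega * tau).
  by rewrite /Th; ring.
apply: (@cone_escape R e `|k| tau eta u Th e1 k_large tau0 ktau eta0).
- by move=> s; apply: cvgB; [apply: cvgM; [exact: cr|exact: cvg_cst]|exact: cvg_cst].
- move=> s; apply: cvgM; first exact: cvg_cst.
  apply: cvgD; last exact: cvg_cst.
  apply: cvgB; first exact: cth.
  apply: cvgM; first exact: cvg_cst.
  by apply: cvgD; [exact: cvg_id|exact: cvg_cst].
- move=> s sI; split; first exact: u_past.
  have [_ _ thE] := past s sI.
  pose Psi x := omega * x + sg * (eta * expR (nu * x)).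
  have -> : Th s = (sg * sg) * (eta * expR (nu * s)).
    have : th s = Psi s - Psi (- tau).
      rewrite thE; apply: (@Rintegral_derive _ Psi psi psi) => //.
      + by case/andP: sI.
      + exact: continuous_integrable_itv.
      + move=> x _; apply: is_deriveD.
          have := @is_deriveZ _ _ _ id omega x 1 1 (is_derive_id _ _).
          by rewrite [_ *: 1]mulr1.
        apply: (@is_deriveZ _ _ _ (fun x => eta * expR (nu * x)) sg x 1).
        exact: (@is_deriveZ _ _ _ (fun x => expR (nu * x)) eta x 1 _ (is_derive_expRM _ _)).
      + apply: continuous_subspaceT => x; apply: cvgD.
          by apply: cvgM; [exact: cvg_cst|exact: cvg_id].
        do 2 (apply: cvgM; first exact: cvg_cst).
        exact: exp_cont.
    by rewrite /Th /Psi => ->; ring.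
  by rewrite sgsg mul1r.
- move=> t t0; have t1 : t < t + 1 by rewrite ltrDl.
  have t01 : 0 < t + 1 by rewrite addr_gt0.
  have tI : 0 < t < t + 1 by rewrite t0.
  have [+ _] := coupled_solution_relative tau rho omega tau0 rho0 rho_cos rho_sin
    (t + 1) r v t (sol _ t01) tI.
  by rewrite ThD -sgk radial_field_sym// -DE// ltW.
- move=> t t0; have t1 : t < t + 1 by rewrite ltrDl.
  have t01 : 0 < t + 1 by rewrite addr_gt0.
  have tI : 0 < t < t + 1 by rewrite t0.
  have [_ vE] := coupled_solution_relative tau rho omega tau0 rho0 rho_cos rho_sin
    (t + 1) r v t (sol _ t01) tI.
  rewrite ThD -sgk angular_field_sym// -DE ?(ltW t0)// -vE.
  apply: (@is_deriveZ _ _ _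
    (fun s => th s - omega * (s + tau) + sg * (eta * expR (nu * - tau))) sg t 1).
  rewrite -[X in is_derive _ _ _ X]addr0; apply: is_deriveD.
  apply: is_deriveB; first exact: thd.
  rewrite -[X in is_derive _ _ _ X]mulr1.
  apply: (@is_deriveZ _ _ _ (fun s => s + tau) omega t 1).
  rewrite -[X in is_derive _ _ _ X]addr0; apply: is_deriveD.
- move=> t tt; pose t' := Num.max t 0.
  have t'0 : 0 <= t' by rewrite le_max lexx orbT.
  have t'1 : 0 < t' + 1 by rewrite ltr_wpDl.
  have t'I : 0 <= t' <= t' + 1 by rewrite t'0 lerDl ler01.
  have [h _] := near_eq _ t' t'1 (sol _ t'1) t'I.
  have -> : u t = (r t - rho) / rho by rewrite /u; field.
  rewrite normrM normfV (gtr0_norm rho0) ler_pdivrMr// mulrC.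
  apply: le_trans eps2; apply/ltW/h; rewrite le_max lexx andbT /t'.
  rewrite lerBlDr ge_max lerDl (ltW tau0)/=.
  by rewrite -lerBlDr sub0r.
- move=> t t0; have t01 : 0 < t + 1 by rewrite ltr_wpDl.
  have tI : 0 <= t <= t + 1 by rewrite t0 lerDl ler01.
  have [_ h] := near_eq _ t t01 (sol _ t01) tI.
  rewrite ThD normsg -DE//; apply: le_trans eps1; apply: le_trans (ltW h).
  apply: le_normr_Rintegral => //.
  have ivt := v_int t t0.
  have ic : mu.-integrable `[t - tau, t] (EFin \o cst omega).
    by apply: continuous_integrable_itv => x; exact: cvg_cst.
  exact: (@integrableB _ _ _ mu _ (measurable_itv _) (EFin \o v) (EFin \o cst omega)).
Qed.

End Instability.

(** * Solutions of constant radius and angular velocity *)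

Section RotatingSolutions.
Context {R : realType}.
Implicit Types (tau rho omega t x y a B : R).

Lemma is_derive_unique (f : R -> R) t (x y : R) :
  is_derive t 1 f x -> is_derive t 1 f y -> x = y.
Proof. by move=> [_ <-] [_ <-]. Qed.

Lemma is_derive_rotation rho omega t :
  is_derive t 1 (fun s => rho * cos (omega * s)) (- (rho * omega * sin (omega * t))) /\
  is_derive t 1 (fun s => rho * sin (omega * s)) (rho * omega * cos (omega * t)).
Proof.
have h : is_derive t 1 (fun s : R => omega * s) omega.
  have := @is_deriveZ _ _ _ id omega t 1 1 (is_derive_id _ _).
  by rewrite [_ *: 1]mulr1.
split.
  have h1 := @is_derive1_comp _ cos _ t _ _ (is_derive_cos _) h.
  have := @is_deriveZ _ _ _ _ rho t 1 _ h1.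
  by move/is_derive_eq; apply; rewrite /GRing.scale /=; ring.
have h1 := @is_derive1_comp _ sin _ t _ _ (is_derive_sin _) h.
have := @is_deriveZ _ _ _ _ rho t 1 _ h1.
by move/is_derive_eq; apply; rewrite /GRing.scale /=; ring.
Qed.

(** The equations at time zero already give the two conditions; conversely these
    suffice by the addition formulas. *)
Lemma rotating_solutionP tau rho omega : rotating_solution tau rho omega <->
  [/\ 0 < rho, rho ^+ 2 * cos (omega * tau) = 1 &
      omega = 1 + rho ^+ 2 * sin (omega * tau)].
Proof.
split=> [[rho0 sol]|[rho0 rho_cos rho_sin]].
  have rhoN0 : rho != 0 by rewrite gt_eqF.
  have [d1 d2] := sol 0; have [r1 r2] := is_derive_rotation rho omega 0.
  have e1 := is_derive_unique _ _ _ _ d1 r1; have e2 := is_derive_unique _ _ _ _ d2 r2.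
  have z : omega * 0 = 0 by rewrite mulr0.
  have z' : omega * (0 - tau) = - (omega * tau) by ring.
  rewrite z z' cosN sinN cos0 sin0 in e1 e2.
  split => //; apply: (mulfI rhoN0).
    set X := (X in X = _) in e1.
    have -> : rho * (rho ^+ 2 * cos (omega * tau)) = rho * 1 - X by rewrite /X; ring.
    by rewrite e1; ring.
  set X := (X in X = _) in e2.
  have -> : rho * (1 + rho ^+ 2 * sin (omega * tau)) = X by rewrite /X; ring.
  by rewrite e2; ring.
split=> // t; have [r1 r2] := is_derive_rotation rho omega t.
have ks : rho ^+ 2 * sin (omega * tau) = omega - 1 by rewrite [in RHS]rho_sin addrC addKr.
have cs : cos (omega * t) ^+ 2 + sin (omega * t) ^+ 2 = 1 := cos2Dsin2 _.
have sq : (rho * cos (omega * t)) ^+ 2 + (rho * sin (omega * t)) ^+ 2 = rho ^+ 2.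
  by rewrite !exprMn -mulrDr cs mulr1.
split; [move/is_derive_eq : r1|move/is_derive_eq : r2]; apply; rewrite sq mulrBr.
  rewrite cosB.
  rewrite [X in _ = _ - X](_ : _ = rho * cos (omega * t) * (rho ^+ 2 * cos (omega * tau))
    + rho * sin (omega * t) * (rho ^+ 2 * sin (omega * tau))); last by ring.
  by rewrite rho_cos ks; ring.
rewrite sinB.
rewrite [X in _ = _ - X](_ : _ = rho * sin (omega * t) * (rho ^+ 2 * cos (omega * tau))
    - rho * cos (omega * t) * (rho ^+ 2 * sin (omega * tau))); last by ring.
by rewrite rho_cos ks; ring.
Qed.

(** The conditions of [rotating_solutionP] say that [rho^2 = 1 / cos phi] and
    [phi / tau - 1 = tan phi], where [phi = omega tau]. *)
Lemma rotating_solution_of_phase tau phi : 0 < tau -> 0 < cos phi ->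
  sin phi = (phi / tau - 1) * cos phi ->
  rotating_solution tau (Num.sqrt (cos phi))^-1 (phi / tau).
Proof.
move=> tau0 c0 h; apply/rotating_solutionP.
have tauN0 : tau != 0 by rewrite gt_eqF.
have cN0 : cos phi != 0 by rewrite gt_eqF.
rewrite divfK// exprVn sqr_sqrtr ?(ltW c0)// mulVf// h; split => //.
  by rewrite invr_gt0 sqrtr_gt0.
by field; rewrite tauN0.
Qed.

(** On [2 n pi, 2 n pi + pi / 2] the difference of the two sides of the phase
    equation, multiplied by the cosine to remove the pole, changes sign. *)
Lemma fast_rotations_exist tau B : 0 < tau ->
  exists rho omega, [/\ rotating_solution tau rho omega, B < omega,
    400 <= `|omega - 1| & 9 / 10 <= `|omega - 1| * tau].
Proof.
move=> tau0; pose y := tau * (`|B| + 401) + 1.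
have [n ny] : exists n : nat, y <= n%:R.
  exists (Num.bound `|y|); apply: ltW; apply: le_lt_trans (ler_norm y) _.
  exact: archi_boundP.
pose a : R := pi *+ 2 *+ n.
have ya : y <= a.
  apply: (le_trans ny); rewrite /a -[leRHS]mulr_natr ler_peMl//.
  by have := pi_ge2 R; rewrite mulr2n; lra.
have B0 := normr_ge0 B.
have tB : 0 <= tau * `|B| by rewrite mulr_ge0// ltW.
pose g x := sin x - ((x + a) / tau - 1) * cos x.
have g_cont : continuous g.
  move=> x; apply: cvgB; first exact: continuous_sin.
  apply: cvgM; last exact: continuous_cos.
  apply: cvgB; last exact: cvg_cst.
  by apply: cvgM; [apply: cvgD; [exact: cvg_id|exact: cvg_cst]|exact: cvg_cst].
have aty : 401 + `|B| <= a / tau.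
  by rewrite ler_pdivlMr//; move: ya; rewrite /y; lra.
have g0 : g 0 <= 0.
  by rewrite /g sin0 cos0 add0r mulr1; move: aty B0; lra.
have g1 : 0 <= g (pi / 2) by rewrite /g sin_pihalf cos_pihalf mulr0 subr0.
have pih : 0 <= pi / 2 :> R by rewrite divr_ge0// pi_ge0.
have [x] : exists2 x, x \in `[0, pi / 2] & g x = 0.
  apply: IVT => //; first exact: continuous_subspaceT.
  by rewrite ge_min g0/= le_max g1 orbT.
rewrite in_itv/= => /andP[x0 xpi] gx.
have cx0 : 0 <= cos x by apply: cos_ge0_pihalf; rewrite xpi andbT; lra.
have cx : 0 < cos x.
  rewrite lt_def cx0 andbT; apply/eqP => c0; have := cos2Dsin2 x.
  move: gx; rewrite /g c0 mulr0 subr0 => ->; rewrite expr0n/= addr0.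
  by move/eqP; rewrite eq_sym oner_eq0.
have sE : sin (x + a) = sin x by rewrite /a (periodicn (@sinD2pi R)).
have cE : cos (x + a) = cos x by rewrite /a (periodicn (@cosD2pi R)).
have rot : rotating_solution tau (Num.sqrt (cos (x + a)))^-1 ((x + a) / tau).
  apply: rotating_solution_of_phase => //; first by rewrite cE.
  by rewrite sE cE; apply/eqP; rewrite -subr_eq0; apply/eqP.
have om : 401 + `|B| <= (x + a) / tau.
  by apply: (le_trans aty); rewrite ler_pM2r ?invr_gt0// lerDr.
exists (Num.sqrt (cos (x + a)))^-1, ((x + a) / tau); split => //.
- by apply: lt_le_trans om; have := ler_norm B; lra.
- by rewrite ger0_norm; move: om B0; lra.
- rewrite ger0_norm; last by move: om B0; lra.
  by rewrite mulrBl divfK ?gt_eqF// mul1r; move: ya x0 tB tau0; rewrite /y; lra.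
Qed.

Lemma slow_rotation_exists tau : 0 < tau -> tau <= 100^-1 ->
  exists rho omega, rotating_solution tau rho omega /\ `|omega - 1| <= 20^-1.
Proof.
move=> tau0 tau1; pose g x := (x / tau - 1) * cos x - sin x.
have g_cont : continuous g.
  move=> x; apply: cvgB; last exact: continuous_sin.
  apply: cvgM; last exact: continuous_cos.
  apply: cvgB; last exact: cvg_cst.
  by apply: cvgM; [exact: cvg_id|exact: cvg_cst].
have tau2 : 0 <= 2 * tau by rewrite mulr_ge0// ltW.
have g0 : g 0 <= 0 by rewrite /g sin0 cos0 mul0r sub0r subr0 mulr1; lra.
have g1 : 0 <= g (2 * tau).
  rewrite /g mulfK ?gt_eqF//.
  have := cos_ge (2 * tau).
  have : sin (2 * tau) <= 2 * tau.
    apply: (le_trans (ler_norm _)); apply: (le_trans (ler_norm_sin _)).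
    by rewrite ger0_norm.
  by nra.
have [x] : exists2 x, x \in `[0, 2 * tau] & g x = 0.
  apply: IVT => //; first exact: continuous_subspaceT.
  by rewrite ge_min g0/= le_max g1 orbT.
rewrite in_itv/= => /andP[x0 xtau] gx.
have cx : 9 / 10 <= cos x by have := cos_ge x; nra.
have sE : sin x = (x / tau - 1) * cos x by apply/eqP; rewrite eq_sym -subr_eq0; apply/eqP.
exists (Num.sqrt (cos x))^-1, (x / tau); split.
  by apply: rotating_solution_of_phase => //; apply: lt_le_trans cx; lra.
have cx0 : 0 <= cos x by lra.
have := ler_norm_sin x; rewrite sE normrM (ger0_norm x0) (ger0_norm cx0).
by have := normr_ge0 (x / tau - 1); nra.
Qed.

(** A phase [tau + k tau] below 91/100 has cosine at least 1/2, which bounds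
    [k = tan phi] by 2 and in turn makes the phase of order [tau]. *)
Lemma slow_rotation_phase tau rho omega : 0 < tau -> tau <= 1000^-1 ->
  rotating_solution tau rho omega -> `|omega - 1| * tau < 9 / 10 ->
  `|omega * tau| <= 100^-1 /\ 99 / 100 <= cos (omega * tau).
Proof.
move=> tau0 tau1 /rotating_solutionP[rho0 rho_cos rho_sin] k_small.
set phi := omega * tau in rho_cos rho_sin *.
have phiE : phi = tau + (omega - 1) * tau by rewrite /phi; ring.
have phi1 : `|phi| <= 91 / 100.
  rewrite phiE; apply: (le_trans (ler_normD _ _)).
  by rewrite normrM (gtr0_norm tau0); lra.
have sq x y : `|x| <= y -> x ^+ 2 <= y ^+ 2.
  by move=> xy; rewrite -real_normK ?num_real// lerXn2r ?nnegrE// (le_trans _ xy).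
have c1 : 1 / 2 <= cos phi.
  by apply: le_trans (cos_ge phi); have := sq _ _ phi1; lra.
have rho2 : rho ^+ 2 <= 2.
  have : rho ^+ 2 * (1 / 2) <= rho ^+ 2 * cos phi.
    by apply: ler_wpM2l => //; exact: sqr_ge0.
  by rewrite rho_cos; lra.
have k2 : `|omega - 1| <= 2.
  have -> : omega - 1 = rho ^+ 2 * sin phi by rewrite [in LHS]rho_sin addrC addKr.
  have : `|rho ^+ 2 * sin phi| <= 2 * 1.
    by apply: ler_normM; [rewrite ger0_norm ?sqr_ge0|exact: sin_max].
  by lra.
have phi2 : `|phi| <= 100^-1.
  rewrite phiE; apply: (le_trans (ler_normD _ _)); rewrite normrM (gtr0_norm tau0).
  have : `|omega - 1| * tau <= 2 * tau by rewrite ler_pM2r.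
  by lra.
split=> //; apply: le_trans (cos_ge phi); have := sq _ _ phi2; lra.
Qed.

(** Near zero the line [phi / tau - 1] is much steeper than the tangent, so they
    meet only once. *)
Lemma slow_rotation_unique tau (rho omega rho' omega' : R) : 0 < tau -> tau <= 1000^-1 ->
  rotating_solution tau rho omega -> rotating_solution tau rho' omega' ->
  `|omega - 1| * tau < 9 / 10 -> `|omega' - 1| * tau < 9 / 10 ->
  (rho, omega) = (rho', omega').
Proof.
move=> tau0 tau1 sol sol' ks ks'.
have [_ c1] := slow_rotation_phase _ _ _ tau0 tau1 sol ks.
have [_ c1'] := slow_rotation_phase _ _ _ tau0 tau1 sol' ks'.
move/rotating_solutionP : sol => [rho0 rc rs].
move/rotating_solutionP : sol' => [rho0' rc' rs'].
have omegaE : omega = omega'.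
  set p := omega * tau in rc rs c1; set p' := omega' * tau in rc' rs' c1'.
  set r := rho ^+ 2 in rc rs; set r' := rho' ^+ 2 in rc' rs'.
  have key : (omega - omega') * (cos p * cos p') = sin (p - p').
    have -> : (omega - omega') * (cos p * cos p') =
      (omega - 1) * cos p * cos p' - (omega' - 1) * cos p' * cos p by ring.
    have -> : omega - 1 = r * sin p by rewrite [in LHS]rs addrC addKr.
    have -> : omega' - 1 = r' * sin p' by rewrite [in LHS]rs' addrC addKr.
    rewrite sinB [LHS](_ : _ = (r * cos p) * (sin p * cos p') -
      (r' * cos p') * (sin p' * cos p)); last by ring.
    by rewrite rc rc'; ring.
  have cc : 9 / 10 <= cos p * cos p'.
    have : 99 / 100 * (99 / 100) <= cos p * cos p' by apply: ler_pM => //; lra.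
    by lra.
  have : `|omega - omega'| * (9 / 10) <= `|omega - omega'| * tau.
    apply: (@le_trans _ _ `|sin (p - p')|).
      rewrite -key normrM; apply: ler_wpM2l => //.
      by rewrite ger0_norm//; lra.
    apply: (le_trans (ler_norm_sin _)); rewrite -mulrBl normrM.
    by rewrite (gtr0_norm tau0).
  have := normr_ge0 (omega - omega') => n0 le_tau.
  have : `|omega - omega'| * tau <= `|omega - omega'| * 1000^-1 by apply: ler_wpM2l.
  move=> h; apply/eqP; rewrite -subr_eq0 -normr_le0; lra.
subst omega'; congr pair.
have : rho ^+ 2 = rho' ^+ 2.
  by apply: (mulIf (_ : cos (omega * tau) != 0)); [rewrite gt_eqF//; lra|rewrite rc rc'].
by move/eqP; rewrite eqrXn2 ?(ltW rho0) ?(ltW rho0')// => /eqP.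
Qed.

End RotatingSolutions.

Theorem theorem2 (R : realType) :
  (forall tau : R, 0 < tau ->
     infinite_set [set p : R * R | rotating_solution tau p.1 p.2 /\
                                   unstable tau p.1 p.2]) /\
  (exists2 taustar : R, 0 < taustar &
     forall tau : R, 0 < tau < taustar ->
       exists! p : R * R, rotating_solution tau p.1 p.2 /\
                          asymptotically_stable tau p.1 p.2).
Proof.
split.
  move=> tau tau0 /finite_seqP[s sE].
  have [B sB] : exists B : R, forall p, p \in s -> p.2 <= B.
    elim: s {sE} => [|p s [B IH]]; first by exists 0.
    exists (Num.max p.2 B) => q; rewrite inE le_max => /predU1P[->|/IH ->].
      by rewrite lexx.
    by rewrite orbT.
  have [rho [omega [rot Bw k_large ktau]]] := fast_rotations_exist tau B tau0.
  have [rho0 rc rs] := (rotating_solutionP tau rho omega).1 rot.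
  have : [set` s] (rho, omega).
    rewrite -sE; split => //=; exact: fast_rotation_unstable.
  by move=> /= /sB /=; rewrite leNgt Bw.
exists (1000^-1); first by lra.
move=> tau /andP[tau0 tau1].
have tau2 : tau <= 100^-1 by lra.
have [rho [omega [rot ks]]] := slow_rotation_exists tau tau0 tau2.
have [rho0 rc rs] := (rotating_solutionP tau rho omega).1 rot.
exists (rho, omega); split=> [|[rho' omega'] [/= rot' [stable' _]]].
  by split=> //=; exact: small_delay_asymptotically_stable.
have kt : `|omega - 1| * tau < 9 / 10.
  have : `|omega - 1| * tau <= 20^-1 * 100^-1 by apply: ler_pM => //; exact: ltW.
  by lra.
have kt' : `|omega' - 1| * tau < 9 / 10.
  have [rho0' rc' rs'] := (rotating_solutionP tau rho' omega').1 rot'.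
  rewrite ltNge; apply/negP => ktau.
  apply: (@fast_rotation_unstable R tau rho' omega') => //.
  rewrite leNgt; apply/negP => k400.
  have : `|omega' - 1| * tau <= 400 * 1000^-1.
    by apply: ler_pM; [exact: normr_ge0|exact: ltW|exact: ltW|exact: ltW].
  by lra.
exact: slow_rotation_unique (ltW tau1) rot rot' kt kt'.
Qed.
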